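(* Let $\Gamma$ be the fundamental group of a closed surface of negative Euler characteristic. For any $(G,Y)$-Anosov representation $\rho:\Gamma\to G=\mathrm{SL}(3,\mathbb R)$, the action of $\rho(\Gamma)$ on the associated domain $\Omega=\{([u],[u^*])\in X:[u]\notin L,\ [u^*]\notin L^*\}$ of the flag variety $X$ is free and properly discontinuous.
   Context: Flags and frames. $V=\mathbb R^3$ with canonical basis $(e_1,e_2,e_3)$; $V^*$ is its dual, with pairing $\langle\cdot\mid\cdot\rangle$; $P(V),P(V^* )$ are the projective planes. $G=\mathrm{SL}(3,\mathbb R)\cong\mathrm{PGL}(3,\mathbb R)$ acts on $V$, and on $V^*$ by $g^*=(g^{-1})^{T}$. The flag variety is $X=\{([v],[v^*])\in P(V)\times P(V^* ):\langle v\mid v^*\rangle=0\}$. The frame variety $Y$ is the space of triples $([u],[v],[w])$ of non-collinear points of $P(V)$. For distinct $[u],[v]\in P(V)$, $[(uv)^*]\in P(V^* )$ is the class of linear forms vanishing on $\mathrm{span}(u,v)$. Define $\pi_\pm:Y\to X$ by $\pi_+([u],[v],[w])=([u],[(uv)^*])$, $\pi_-([u],[v],[w])=([w],[(wv)^*])$. Let $E^\pm\subset TY$ be the tangent bundle to the fibers of $\pi_\pm$; then $TY=E^+\oplus E^-$, $G$-invariantly. Anosov representations. $\Gamma$ is embedded as a discrete subgroup of $H=\mathrm{SL}(2,\mathbb R)$; $M=\Gamma\backslash H$, with the flow $\Phi^t$ induced by right multiplication by $a^t=\mathrm{diag}(e^t,e^{-t})$. For a representation $\rho:\Gamma\to G$,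 $E_\rho$ is the quotient of $H\times Y$ by $\gamma(h,y)=(\gamma h,\rho(\gamma)y)$, a flat bundle $\pi_\rho:E_\rho\to M$ with fiber $Y$; the flow $(h,y)\mapsto(ha^t,y)$ induces a flow $\Phi^t_\rho$ on $E_\rho$, and $E^\pm$ induce $\Phi_\rho^t$-invariant subbundles $E^\pm_\rho$ of the vertical tangent bundle of $E_\rho$. $\rho$ is $(G,Y)$-Anosov if there is a continuous section $s$ of $\pi_\rho$ whose image $S$ is $\Phi^t_\rho$-invariant and such that, for any continuous norm $\|\cdot\|$ on the vertical tangent bundle, there are $a,b>0$ with $\|D_p\Phi^t_\rho(v^+)\|\le be^{-at}\|v^+\|$ and $\|D_p\Phi^{-t}_\rho(v^-)\|\le be^{-at}\|v^-\|$ for all $p\in S$, $t>0$, and $v^\pm\in E^\pm_\rho$ over $p$. Limit objects. For a $(G,Y)$-Anosov $\rho$, the section $s$ lifts to a continuous map $f:H\to Y$ with $f(\gamma h)=\rho(\gamma)f(h)$ and $f(ha^t)=f(h)$. The limit curve is $\Lambda=\pi_+(f(H))\subset X$, which also equals $\pi_-(f(H))$. $L\subset P(V)$ and $L^*\subset P(V^* )$ are the images of $\Lambda$ under the projections $X\to P(V)$, $X\to P(V^* )$. *)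

(* Defs.v *)
(* The real numbers are any R : realType. *)
From HB Require Import structures.
From mathcomp Require Import all_boot all_order all_algebra generic_quotient.
From mathcomp Require Import all_classical all_reals all_analysis.

Set Implicit Arguments.
Unset Strict Implicit.
Unset Printing Implicit Defensive.

Import Order.TTheory GRing.Theory Num.Theory.
Import numFieldNormedType.Exports.

Local Open Scope classical_set_scope.
Local Open Scope ring_scope.
Local Open Scope quotient_scope.

(** * Closed surface groups of negative Euler characteristic

  By the classification of closed surfaces, the fundamental group of the closed
  orientable surface of genus g is
    < a_1, b_1, .., a_g, b_g | [a_1, b_1] .. [a_g, b_g] >,  chi = 2 - 2g,
  and that of the non-orientable surface with k cross-caps is
    < c_1, .., c_k | c_1 ^ 2 .. c_k ^ 2 >,                  chi = 2 - k. *)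

(* (i, true) is the i-th generator and (i, false) its inverse. *)
Definition word (I : Type) := seq (I * bool).

(* Equality in the group presented by one relator r: the quotient of the free
   group by the normal closure of r. *)
Inductive presented_eq (I : Type) (r : word I) : word I -> word I -> Prop :=
| pres_refl w : presented_eq r w w
| pres_sym w w' : presented_eq r w w' -> presented_eq r w' w
| pres_trans w w' w'' :
    presented_eq r w w' -> presented_eq r w' w'' -> presented_eq r w w''
| pres_cat u w w' v :
    presented_eq r w w' -> presented_eq r (u ++ w ++ v) (u ++ w' ++ v)
| pres_cancel i b : presented_eq r [:: (i, b); (i, ~~ b)] [::]
| pres_relator : presented_eq r r [::].

Definition word_eval (G : groupType) (I : Type) (x : I -> G) (w : word I) : G :=
  (\prod_(l <- w) (if l.2 then x l.1 else (x l.1)^-1))%g.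

Definition has_presentation (G : groupType) (I : Type) (r : word I) :=
  exists x : I -> G,
    (forall g, exists w, word_eval x w = g) /\
    (forall w, word_eval x w = 1%g <-> presented_eq r w [::]).

(* Generators a_i = (i, false) and b_i = (i, true); [a, b] = a b a^-1 b^-1. *)
Definition orientable_relator (g : nat) : word ('I_g * bool) :=
  flatten [seq [:: ((i, false), true); ((i, true), true);
                   ((i, false), false); ((i, true), false)] | i <- enum 'I_g].

Definition nonorientable_relator (k : nat) : word 'I_k :=
  flatten [seq [:: (i, true); (i, true)] | i <- enum 'I_k].

Definition negative_closed_surface_group (G : groupType) :=
  (exists2 g : nat, (2 - 2 * g%:Z < 0 :> int) &
     has_presentation G (orientable_relator g)) \/
  (exists2 k : nat, (2 - k%:Z < 0 :> int) &
     has_presentation G (nonorientable_relator k)).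

Definition set_pt (T : Type) (A : set T) (x : T) (Ax : A x) : A :=
  exist _ x (mem_set Ax).

(* [orb x] is meant to be the orbit of x; two points are identified when their
   orbits coincide.  The orbit space carries the quotient topology. *)
Section OrbitSpace.
Variables (T : topologicalType) (orb : T -> set T).

Definition orbit_rel : rel T := fun x y => `[< orb x = orb y >].

Lemma orbit_rel_refl : reflexive orbit_rel.
Proof. by move=> x; apply/asboolP. Qed.

Lemma orbit_rel_sym : symmetric orbit_rel.
Proof. by move=> x y; apply/asboolP/asboolP => /esym. Qed.

Lemma orbit_rel_trans : transitive orbit_rel.
Proof.
by move=> y x z /asboolP xy /asboolP yz; apply/asboolP; rewrite xy.
Qed.

Definition orbit_equiv := EquivRel orbit_rel
  orbit_rel_refl orbit_rel_sym orbit_rel_trans.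

Definition orbit_space := quotient_topology {eq_quot orbit_equiv}.

HB.instance Definition _ := Topological.on orbit_space.
HB.instance Definition _ := Quotient.on orbit_space.

Definition orbit_class (x : T) : orbit_space := \pi_orbit_space x.

Lemma orbit_classP x y : orbit_class x = orbit_class y <-> orb x = orb y.
Proof.
split=> [xy|xy].
  by apply/asboolP; have /eqmodP := xy.
by apply/eqmodP/asboolP.
Qed.

Lemma orbit_class_mem :
  (forall x, orb x x) -> (forall x y, orb x y -> orb x = orb y) ->
  forall x y, orbit_class x = orbit_class y <-> orb x y.
Proof.
move=> orb_refl orbE x y; rewrite orbit_classP.
by split=> [->|/orbE//]; exact: orb_refl.
Qed.

End OrbitSpace.

Section SpecialLinear.
Variables (R : realType) (n : nat).

Definition SL := set_type [set g : 'M[R]_n | \det g = 1].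

HB.instance Definition _ := Topological.on SL.

Lemma SL_det (g : SL) : \det (val g) = 1.
Proof. exact: (set_mem (valP g)). Qed.

Lemma SL_unitmx (g : SL) : val g \in unitmx.
Proof. by rewrite unitmxE SL_det unitr1. Qed.

Lemma SL_one_subproof : [set g : 'M[R]_n | \det g = 1] 1%:M.
Proof. exact: det1. Qed.

Lemma SL_mul_subproof (g h : SL) :
  [set g : 'M[R]_n | \det g = 1] (val g *m val h).
Proof. by rewrite /= det_mulmx !SL_det mulr1. Qed.

Lemma SL_inv_subproof (g : SL) :
  [set g : 'M[R]_n | \det g = 1] (invmx (val g)).
Proof. by rewrite /= det_inv SL_det invr1. Qed.

Definition SL_one : SL := set_pt SL_one_subproof.
Definition SL_mul (g h : SL) : SL := set_pt (SL_mul_subproof g h).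
Definition SL_inv (g : SL) : SL := set_pt (SL_inv_subproof g).

Lemma SL_mulA : associative SL_mul.
Proof. by move=> g h k; apply: val_inj; rewrite /= mulmxA. Qed.

Lemma SL_mul1 : left_id SL_one SL_mul.
Proof. by move=> g; apply: val_inj; rewrite /= mul1mx. Qed.

Lemma SL_mulr1 : right_id SL_one SL_mul.
Proof. by move=> g; apply: val_inj; rewrite /= mulmx1. Qed.

Lemma SL_mulV : left_inverse SL_one SL_inv SL_mul.
Proof. by move=> g; apply: val_inj; rewrite /= mulVmx// SL_unitmx. Qed.

Lemma SL_mulrV : right_inverse SL_one SL_inv SL_mul.
Proof. by move=> g; apply: val_inj; rewrite /= mulmxV// SL_unitmx. Qed.

HB.instance Definition _ :=
  isGroup.Build SL SL_mulA SL_mul1 SL_mulr1 SL_mulV SL_mulrV.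

End SpecialLinear.

Section Flow.
Variable R : realType.

Definition diag_exp (t : R) : 'M[R]_2 :=
  diag_mx (\row_j (if j == 0 then expR t else expR (- t))).

Lemma diag_exp_det t : [set g : 'M[R]_2 | \det g = 1] (diag_exp t).
Proof.
rewrite /= det_diag big_ord_recl big_ord1 !mxE /=.
by rewrite expRN mulfV// gt_eqF// expR_gt0.
Qed.

Definition geod (t : R) : SL R 2 := set_pt (diag_exp_det t).

End Flow.

(** * Projective planes, flags and frames

  V is the space 'cV[R]_3 of column vectors and V^* the space 'rV[R]_3 of row
  vectors, the pairing being <v | l> = l *m v.  In these coordinates the
  contragredient action of g on V^* is l |-> l *m g^-1. *)

Section Projective.
Variables (R : realType) (m n : nat).
Local Notation E := 'M[R]_(m.+1, n.+1).

Definition nonzero := set_type [set u : E | u != 0].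
HB.instance Definition _ := Topological.on nonzero.

Definition homothety_orbit (u : nonzero) : set nonzero :=
  [set v | exists2 c : R, c != 0 & val v = c *: val u].

Definition proj := orbit_space homothety_orbit.
HB.instance Definition _ := Topological.on proj.
HB.instance Definition _ := Quotient.on proj.

Lemma const1_nonzero : [set u : E | u != 0] (const_mx 1).
Proof.
apply/negP => /eqP/matrixP/(_ 0 0); rewrite !mxE => /eqP.
by rewrite oner_eq0.
Qed.

(* [u], meaningful only for u != 0. *)
Definition pclass (u : E) : proj :=
  orbit_class homothety_orbit (insubd (set_pt const1_nonzero : nonzero) u).

Definition prepr (x : proj) : E := val (repr x).

Lemma prepr_neq0 x : prepr x != 0.
Proof. exact: (set_mem (valP (repr x))). Qed.

Lemma preprK x : pclass (prepr x) = x.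
Proof. by rewrite /pclass /prepr valKd /orbit_class reprK. Qed.

Lemma prepr_pclass u : u != 0 ->
  exists2 c : R, c != 0 & prepr (pclass u) = c *: u.
Proof.
move=> u0.
have e : pclass (prepr (pclass u)) = pclass u by rewrite preprK.
have uin : u \in [set u : E | u != 0] by apply/mem_set.
have /orbit_classP/esym oE := e.
have vu : val (insubd (set_pt const1_nonzero : nonzero) u) = u.
  by rewrite insubdK.
have : homothety_orbit (insubd (set_pt const1_nonzero : nonzero)
   (prepr (pclass u))) (repr (pclass u)).
  by exists 1; rewrite ?oner_neq0// scale1r insubdK//; exact/mem_set/prepr_neq0.
by rewrite -oE => -[c c0]; rewrite vu => cE; exists c.
Qed.

Lemma pclassZ (c : R) u : c != 0 -> u != 0 -> pclass (c *: u) = pclass u.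
Proof.
move=> c0 u0; apply/orbit_classP.
have cu : c *: u \in [set u : E | u != 0] by apply/mem_set; rewrite /= scaler_eq0 negb_or c0.
have uu : u \in [set u : E | u != 0] by apply/mem_set.
rewrite /homothety_orbit !insubdK//.
apply/seteqP; split=> v /= [d d0 ->].
  by exists (d * c); rewrite ?mulf_neq0// scalerA.
by exists (d / c); rewrite ?mulf_neq0 ?invr_eq0// scalerA divfK.
Qed.

End Projective.

Section Flags.
Variable R : realType.

Definition PV := proj R 2 0.
Definition PVd := proj R 0 2.
HB.instance Definition _ := Topological.on PV.
HB.instance Definition _ := Topological.on PVd.

Definition incident (x : PV) (l : PVd) : Prop := prepr l *m prepr x = 0.

Lemma incidentP (u : 'cV[R]_3) (l : 'rV[R]_3) : u != 0 -> l != 0 ->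
  incident (pclass u) (pclass l) <-> l *m u = 0.
Proof.
move=> u0 l0; rewrite /incident.
have [c c0 ->] := prepr_pclass u0; have [d d0 ->] := prepr_pclass l0.
rewrite -scalemxAl -scalemxAr scalerA.
by split=> [/eqP|->]; rewrite ?scaler0// scaler_eq0 mulf_eq0 (negPf c0) (negPf d0) => /eqP.
Qed.

Lemma unitmx_neq0 (g : 'M[R]_3) (u : 'cV[R]_3) :
  g \in unitmx -> u != 0 -> g *m u != 0.
Proof.
by move=> gU; apply: contra_neq => gu0; rewrite -(mulKmx gU u) gu0 mulmx0.
Qed.

Definition actV (g : SL R 3) (x : PV) : PV := pclass (val g *m prepr x).

Lemma actV_pclass g (u : 'cV[R]_3) : u != 0 ->
  actV g (pclass u) = pclass (val g *m u).
Proof.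
move=> u0; rewrite /actV; have [c c0 ->] := prepr_pclass u0.
rewrite -scalemxAr pclassZ//; apply: contra_neq u0 => gu0.
by rewrite -(mulKmx (SL_unitmx g) u) gu0 mulmx0.
Qed.

Definition actVd (g : SL R 3) (l : PVd) : PVd :=
  pclass (prepr l *m invmx (val g)).

Lemma actVd_pclass g (l : 'rV[R]_3) : l != 0 ->
  actVd g (pclass l) = pclass (l *m invmx (val g)).
Proof.
move=> l0; rewrite /actVd; have [c c0 ->] := prepr_pclass l0.
rewrite -scalemxAl pclassZ//; apply: contra_neq l0 => lg0.
by rewrite -(mulmxKV (SL_unitmx g) l) lg0 mul0mx.
Qed.

Definition actF (g : SL R 3) (x : PV * PVd) : PV * PVd :=
  (actV g x.1, actVd g x.2).

Definition flags : set (PV * PVd) := [set x | incident x.1 x.2].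

Definition noncollinear : set (PV * PV * PV) :=
  [set y | ~ exists l, [/\ incident y.1.1 l, incident y.1.2 l & incident y.2 l]].

Definition Y := set_type noncollinear.
HB.instance Definition _ := Topological.on Y.

(* [(uv)^*]: for x <> y there is exactly one such l. *)
Definition line_through (x y : PV) : PVd :=
  xget (pclass (const_mx 1)) [set l | incident x l /\ incident y l].

Definition pi_plus (y : Y) : PV * PVd :=
  ((val y).1.1, line_through (val y).1.1 (val y).1.2).
Definition pi_minus (y : Y) : PV * PVd :=
  ((val y).2, line_through (val y).2 (val y).1.2).

Lemma actY_subproof (g : SL R 3) (y : Y) :
  noncollinear (actV g (val y).1.1, actV g (val y).1.2, actV g (val y).2).
Proof.
move=> -[l] /=.
have gU := SL_unitmx g.
have lg0 : prepr l *m val g != 0.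
  apply: contra_neq (prepr_neq0 l) => lg0.
  by rewrite -(mulmxK gU (prepr l)) lg0 mul0mx.
have H x : incident (actV g x) l -> incident x (pclass (prepr l *m val g)).
  have [u0 v0] := (prepr_neq0 x, unitmx_neq0 gU (prepr_neq0 x)).
  rewrite -{1}(preprK l) -{2}(preprK x) !incidentP ?prepr_neq0//.
  by rewrite mulmxA.
case=> /H h1 /H h2 /H h3; apply: (set_mem (valP y)).
by exists (pclass (prepr l *m val g)).
Qed.

Definition actY (g : SL R 3) (y : Y) : Y := set_pt (@actY_subproof g y).

Lemma actV1 x : actV 1%g x = x.
Proof. by rewrite /actV /= mul1mx preprK. Qed.

Lemma actVM g h x : actV (g * h)%g x = actV g (actV h x).
Proof.
rewrite [actV h x]/actV actV_pclass ?unitmx_neq0 ?SL_unitmx ?prepr_neq0//.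
by rewrite /actV /= mulmxA.
Qed.

Lemma actY1 y : actY 1%g y = y.
Proof. by apply: val_inj; rewrite /= !actV1; case: (sval y) => -[]. Qed.

Lemma actYM g h y : actY (g * h)%g y = actY g (actY h y).
Proof. by apply: val_inj; rewrite /= !actVM. Qed.

(** ** The tangent bundle of Y

  Writing the columns of p in GL(3, R) as u, v, w, the map
  p |-> ([u], [v], [w]) identifies Y with the quotient of GL(3, R) by right
  multiplication by invertible diagonal matrices.  A tangent vector of Y is
  therefore represented by a pair (p, xi), xi being a tangent vector of the
  open set GL(3, R) at p, and (p, xi), (p d, xi d + p d') represent the same
  one, for all diagonal d, d' with d invertible: this is the image of (p, xi)
  by the differential of p |-> p d when d varies with velocity d'. *)

Definition GL3 := set_type [set p : 'M[R]_3 | p \in unitmx].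
HB.instance Definition _ := Topological.on GL3.

Lemma GL3_unitmx (p : GL3) : val p \in unitmx.
Proof. exact: (set_mem (valP p)). Qed.

Lemma col_neq0 (p : GL3) (j : 'I_3) : col j (val p) != 0.
Proof.
rewrite colE unitmx_neq0 ?GL3_unitmx//.
apply/eqP => /matrixP/(_ j 0); rewrite !mxE !eqxx => /eqP.
by rewrite oner_eq0.
Qed.

Lemma frame_subproof (p : GL3) :
  noncollinear (pclass (col 0 (val p)), pclass (col 1 (val p)),
                pclass (col 2%:R (val p))).
Proof.
move=> -[l] /=; rewrite -(preprK l).
have H j : incident (pclass (col j (val p))) (pclass (prepr l)) ->
    prepr l *m col j (val p) = 0.
  by move/incidentP; apply; rewrite ?prepr_neq0 ?col_neq0.
case=> /H h0 /H h1 /H h2; have /eqP := prepr_neq0 l; apply.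
rewrite -(mulmxK (GL3_unitmx p) (prepr l)).
suff -> : prepr l *m val p = 0 by rewrite mul0mx.
apply/matrixP => i j.
have -> : (prepr l *m val p) i j = (prepr l *m col j (val p)) i 0.
  by rewrite !mxE; apply: eq_bigr => k _; rewrite !mxE.
suff -> : prepr l *m col j (val p) = 0 by rewrite !mxE.
case: j => -[|[|[|//]]] jlt.
- by rewrite -[RHS]h0; congr (_ *m col _ _); exact: val_inj.
- by rewrite -[RHS]h1; congr (_ *m col _ _); exact: val_inj.
- by rewrite -[RHS]h2; congr (_ *m col _ _); exact: val_inj.
Qed.

Definition frame (p : GL3) : Y := set_pt (@frame_subproof p).

Definition tangent_orbit (q : GL3 * 'M[R]_3) : set (GL3 * 'M[R]_3) :=
  [set q' | exists d d' : 'rV[R]_3,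
     val q'.1 = val q.1 *m diag_mx d /\
     q'.2 = q.2 *m diag_mx d + val q.1 *m diag_mx d'].

Definition TY := orbit_space tangent_orbit.
HB.instance Definition _ := Topological.on TY.
HB.instance Definition _ := Quotient.on TY.

Definition tvec (p : GL3) (xi : 'M[R]_3) : TY :=
  orbit_class tangent_orbit (p, xi).

Lemma tvecP p xi p' xi' :
  tvec p xi = tvec p' xi' <-> tangent_orbit (p, xi) (p', xi').
Proof.
apply: orbit_class_mem => [[q z]|[q z] [q' z']] /=.
  exists (const_mx 1), 0; rewrite diag_const_mx !mulmx1; split=> //.
  by rewrite linear0 mulmx0 addr0.
case=> d [d' /= [qE zE]].
have dU : diag_mx d \in unitmx.
  by move: (GL3_unitmx q') => /=; rewrite qE unitmx_mul => /andP[].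
have d0 j : d 0 j != 0.
  move: dU; rewrite unitmxE det_diag unitfE => /prodf_neq0; exact.
pose e : 'rV[R]_3 := \row_j (d 0 j)^-1.
have de : diag_mx d *m diag_mx e = 1%:M.
  rewrite mulmx_diag -diag_const_mx; congr diag_mx.
  by apply/rowP => j; rewrite !mxE divff.
have deK (X : 'M[R]_3) : X *m diag_mx d *m diag_mx e = X.
  by rewrite -mulmxA de mulmx1.
apply/seteqP; split=> -[r x] [f [f' /= [rE xE]]].
  exists (\row_j (e 0 j * f 0 j)).
  exists (\row_j (e 0 j * f' 0 j - e 0 j * d' 0 j * e 0 j * f 0 j)) => /=.
  have -> : diag_mx (\row_j (e 0 j * f 0 j)) = diag_mx e *m diag_mx f.
    by rewrite mulmx_diag.
  have -> : diag_mx (\row_j (e 0 j * f' 0 j - e 0 j * d' 0 j * e 0 j * f 0 j)) =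
      diag_mx e *m diag_mx f' -
      diag_mx e *m diag_mx d' *m diag_mx e *m diag_mx f.
    rewrite !mulmx_diag -linearB; congr diag_mx.
    by apply/rowP => j; rewrite !mxE.
  rewrite qE zE xE mulmxDl mulmxBr !mulmxA !deK; split=> //.
  by rewrite -[RHS]addrA; congr (_ + _); rewrite addrC subrK.
exists (\row_j (d 0 j * f 0 j)).
exists (\row_j (d' 0 j * f 0 j + d 0 j * f' 0 j)) => /=.
have -> : diag_mx (\row_j (d 0 j * f 0 j)) = diag_mx d *m diag_mx f.
  by rewrite mulmx_diag.
have -> : diag_mx (\row_j (d' 0 j * f 0 j + d 0 j * f' 0 j)) =
    diag_mx d' *m diag_mx f + diag_mx d *m diag_mx f'.
  rewrite !mulmx_diag -linearD; congr diag_mx.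
  by apply/rowP => j; rewrite !mxE.
rewrite rE xE qE zE !mulmxA; split=> //.
by rewrite mulmxDl mulmxDr !mulmxA addrA.
Qed.

Definition baseY (v : TY) : Y := frame (repr v).1.

Lemma actGL_subproof (g : SL R 3) (p : GL3) :
  [set p : 'M[R]_3 | p \in unitmx] (val g *m val p).
Proof. by rewrite /= unitmx_mul SL_unitmx GL3_unitmx. Qed.

Definition actGL (g : SL R 3) (p : GL3) : GL3 := set_pt (actGL_subproof g p).

Definition actTY (g : SL R 3) (v : TY) : TY :=
  tvec (actGL g (repr v).1) (val g *m (repr v).2).

Lemma repr_tvec p xi : tangent_orbit (p, xi) (repr (tvec p xi)).
Proof.
by apply/tvecP; rewrite /tvec -surjective_pairing /orbit_class reprK.
Qed.

Lemma baseY_tvec p xi : baseY (tvec p xi) = frame p.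
Proof.
have [d [d' /= [pE _]]] := repr_tvec p xi.
have dU : diag_mx d \in unitmx.
  move: (GL3_unitmx (repr (tvec p xi)).1) => /=.
  by rewrite pE unitmx_mul => /andP[].
have d0 j : d 0 j != 0.
  move: dU; rewrite unitmxE det_diag unitfE => /prodf_neq0; exact.
have colE j : pclass (col j (val (repr (tvec p xi)).1)) = pclass (col j (val p)).
  rewrite /= pE mul_mx_diag.
  have -> : col j (\matrix_(i, j) (val p i j * d 0 j)) = d 0 j *: col j (val p).
    by apply/colP => i; rewrite !mxE mulrC.
  by rewrite pclassZ// col_neq0.
by apply: val_inj; rewrite /= !colE.
Qed.

Lemma actTY_tvec g p xi : actTY g (tvec p xi) = tvec (actGL g p) (val g *m xi).
Proof.
have [d [d' /= [pE xiE]]] := repr_tvec p xi.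
apply/esym/tvecP; exists d, d'; rewrite /= pE xiE.
by rewrite mulmxDr !mulmxA.
Qed.

Lemma tvecK v : tvec (repr v).1 (repr v).2 = v.
Proof. by rewrite /tvec -surjective_pairing /orbit_class reprK. Qed.

Lemma actTY1 v : actTY 1%g v = v.
Proof.
rewrite -[RHS]tvecK /actTY /= mul1mx; congr tvec.
by apply: val_inj; rewrite /= mul1mx.
Qed.

Lemma actTYM g h v : actTY (g * h)%g v = actTY g (actTY h v).
Proof.
rewrite [actTY h v]/actTY actTY_tvec /actTY /= mulmxA; congr tvec.
by apply: val_inj; rewrite /= mulmxA.
Qed.

Lemma baseY_actTY g v : baseY (actTY g v) = actY g (baseY v).
Proof.
rewrite /actTY baseY_tvec /baseY; apply: val_inj => /=.
by rewrite !actV_pclass ?col_neq0// !colE !mulmxA.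
Qed.

(* The tangent vectors to the fibers of F : Y -> T are the velocities at 0 of
   the curves frame \o c contained in a fiber of F. *)
Definition fiber_tangent (T : Type) (F : Y -> T) : set TY :=
  [set v | exists c : R -> GL3, exists xi : 'M[R]_3,
     [/\ is_derive (0 : R) 1 (fun t => val (c t)) xi,
         (\forall t \near (0 : R), F (frame (c t)) = F (frame (c 0)))
       & v = tvec (c 0) xi]].

Definition E_plus : set TY := fiber_tangent pi_plus.
Definition E_minus : set TY := fiber_tangent pi_minus.

End Flags.

Section Anosov.
Variables (R : realType) (Gam : groupType).
Variable iota : {multiplicative Gam -> SL R 2}.
Variable rho : {multiplicative Gam -> SL R 3}.

Local Notation H := (SL R 2).

Definition M_orbit (h : H) : set H := [set h' | exists g, h' = (iota g * h)%g].
Definition M := orbit_space M_orbit.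
HB.instance Definition _ := Topological.on M.
HB.instance Definition _ := Quotient.on M.

Definition E_orbit (q : H * Y R) : set (H * Y R) :=
  [set q' | exists g, q' = ((iota g * q.1)%g, actY (rho g) q.2)].
Definition Erho := orbit_space E_orbit.
HB.instance Definition _ := Topological.on Erho.
HB.instance Definition _ := Quotient.on Erho.

Definition VE_orbit (q : H * TY R) : set (H * TY R) :=
  [set q' | exists g, q' = ((iota g * q.1)%g, actTY (rho g) q.2)].
(* The vertical tangent bundle Gam \ (H * TY) of E_rho. *)
Definition VE := orbit_space VE_orbit.
HB.instance Definition _ := Topological.on VE.
HB.instance Definition _ := Quotient.on VE.

Definition classM (h : H) : M := orbit_class M_orbit h.
Definition classE (h : H) (y : Y R) : Erho := orbit_class E_orbit (h, y).
Definition classVE (h : H) (v : TY R) : VE := orbit_class VE_orbit (h, v).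

Let gmul1 (G : groupType) (phi : {multiplicative Gam -> G}) : phi 1%g = 1%g.
Proof. by apply: (mulgI (phi 1%g)); rewrite -gmulfM !mulg1. Qed.

Let gmulV (G : groupType) (phi : {multiplicative Gam -> G}) g :
  phi g^-1%g = (phi g)^-1%g.
Proof. by apply: (mulgI (phi g)); rewrite -gmulfM !mulgV gmul1. Qed.

Lemma classM_eq h h' : classM h = classM h' <-> M_orbit h h'.
Proof.
apply: orbit_class_mem => [x|x _ [g ->]].
  by exists 1%g; rewrite gmul1 mul1g.
apply/seteqP; split=> _ [k ->].
  by exists (k * g^-1)%g; rewrite gmulfM gmulV -mulgA mulKg.
by exists (k * g)%g; rewrite gmulfM mulgA.
Qed.

Lemma classE_eq h y h' y' :
  classE h y = classE h' y' <-> E_orbit (h, y) (h', y').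
Proof.
apply: orbit_class_mem => [[x z]|[x z] _ [g ->]] /=.
  by exists 1%g; rewrite !gmul1 mul1g actY1.
apply/seteqP; split=> _ [k ->] /=.
  exists (k * g^-1)%g; rewrite !gmulfM !gmulV -mulgA mulKg.
  by rewrite -actYM -mulgA mulVg mulg1.
by exists (k * g)%g; rewrite !gmulfM mulgA actYM.
Qed.

Lemma classVE_eq h v h' v' :
  classVE h v = classVE h' v' <-> VE_orbit (h, v) (h', v').
Proof.
apply: orbit_class_mem => [[x z]|[x z] _ [g ->]] /=.
  by exists 1%g; rewrite !gmul1 mul1g actTY1.
apply/seteqP; split=> _ [k ->] /=.
  exists (k * g^-1)%g; rewrite !gmulfM !gmulV -mulgA mulKg.
  by rewrite -actTYM -mulgA mulVg mulg1.
by exists (k * g)%g; rewrite !gmulfM mulgA actTYM.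
Qed.

Lemma repr_classE h y : E_orbit (h, y) (repr (classE h y)).
Proof.
by rewrite [repr _]surjective_pairing; apply/classE_eq;
  rewrite /classE -surjective_pairing /orbit_class reprK.
Qed.

Lemma repr_classVE h v : VE_orbit (h, v) (repr (classVE h v)).
Proof.
by rewrite [repr _]surjective_pairing; apply/classVE_eq;
  rewrite /classVE -surjective_pairing /orbit_class reprK.
Qed.

Definition pi_rho (e : Erho) : M := classM (repr e).1.
Definition baseVE (v : VE) : Erho := classE (repr v).1 (baseY (repr v).2).

Definition flowE (t : R) (e : Erho) : Erho :=
  classE ((repr e).1 * geod t)%g (repr e).2.
(* The differential of flowE t along the fibers of pi_rho. *)
Definition flowVE (t : R) (v : VE) : VE :=
  classVE ((repr v).1 * geod t)%g (repr v).2.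

Lemma pi_rho_classE h y : pi_rho (classE h y) = classM h.
Proof.
rewrite /pi_rho; have [g ->] := repr_classE h y.
by apply/esym/classM_eq; exists g.
Qed.

Lemma baseVE_classVE h v : baseVE (classVE h v) = classE h (baseY v).
Proof.
rewrite /baseVE; have [g ->] := repr_classVE h v.
by apply/esym/classE_eq; exists g; rewrite /= baseY_actTY.
Qed.

Lemma flowE_classE t h y : flowE t (classE h y) = classE (h * geod t)%g y.
Proof.
rewrite /flowE; have [g ->] := repr_classE h y.
by apply/esym/classE_eq; exists g; rewrite /= mulgA.
Qed.

Lemma flowVE_classVE t h v : flowVE t (classVE h v) = classVE (h * geod t)%g v.
Proof.
rewrite /flowVE; have [g ->] := repr_classVE h v.
by apply/esym/classVE_eq; exists g; rewrite /= mulgA.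
Qed.

Definition Erho_plus : set VE :=
  [set v | exists h, exists2 x, E_plus x & v = classVE h x].
Definition Erho_minus : set VE :=
  [set v | exists h, exists2 x, E_minus x & v = classVE h x].

(* Vectors with the same base point are of the form classVE h (tvec p xi) with
   common h and p, and the linear structure of the fiber is that of xi. *)
Definition continuous_norm (N : VE -> R) : Prop :=
  continuous N /\
  forall (h : H) (p : GL3 R),
    let v xi := classVE h (tvec p xi) in
    [/\ forall xi xi', N (v (xi + xi')) <= N (v xi) + N (v xi'),
        forall (c : R) xi, N (v (c *: xi)) = `|c| * N (v xi)
      & forall xi, N (v xi) = 0 -> v xi = v 0].

Definition anosov_section (s : M -> Erho) : Prop :=
  [/\ continuous s,
      forall m, pi_rho (s m) = m,
      forall (t : R) m, range s (flowE t (s m))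
    & forall N, continuous_norm N ->
        exists a b : R, [/\ 0 < a, 0 < b &
          forall (t : R) (v : VE), 0 < t -> range s (baseVE v) ->
            (Erho_plus v -> N (flowVE t v) <= b * expR (- (a * t)) * N v) /\
            (Erho_minus v ->
               N (flowVE (- t) v) <= b * expR (- (a * t)) * N v)]].

(* f is the lift of s to H; it is unique when iota is injective, Gam then acting
   freely on H, and it is rho-equivariant. *)
Definition lifts (f : H -> Y R) (s : M -> Erho) : Prop :=
  forall h, s (classM h) = classE h (f h).

Lemma lifts_exists (s : M -> Erho) :
  (forall m, pi_rho (s m) = m) -> exists f, lifts f s.
Proof.
move=> sK; have ex h : exists y, s (classM h) = classE h y.
  have := sK (classM h); set e := s _; move=> eh.
  have eE : e = classE (repr e).1 (repr e).2.
    by rewrite /classE -surjective_pairing /orbit_class reprK.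
  have /classM_eq[g ->] : classM (repr e).1 = classM h by [].
  exists (actY (rho g) (repr e).2); rewrite {1}eE.
  by apply/classE_eq; exists g.
by exists (fun h => sval (cid (ex h))) => h; case: cid.
Qed.

End Anosov.

Section Domain.
Variables (R : realType) (f : SL R 2 -> Y R).

Definition limit_curve : set (PV R * PVd R) := @pi_plus R @` range f.
Definition limit_points : set (PV R) := fst @` limit_curve.
Definition limit_lines : set (PVd R) := snd @` limit_curve.

Definition domain : set (PV R * PVd R) :=
  [set x | [/\ flags x, ~ limit_points x.1 & ~ limit_lines x.2]].

End Domain.

Definition discrete_subset (T : topologicalType) (A : set T) : Prop :=
  A `<=` isolated A.

Section Actions.
Variables (T : topologicalType) (G : groupType) (act : G -> T -> T).
Variables (A : set G) (D : set T).

Definition acts_on := forall g x, A g -> D x -> D (act g x).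

Definition acts_freely := forall g x, A g -> D x -> act g x = x -> g = 1%g.

Definition acts_properly_discontinuously :=
  forall K : set T, compact K -> K `<=` D ->
    finite_set [set g | A g /\ (act g @` K) `&` K !=set0].

End Actions.

(* Main.v *)
Require Import Defs.
From HB Require Import structures.
From mathcomp Require Import all_boot all_order all_algebra ring lra.
From mathcomp Require Import all_classical all_reals all_analysis.

(** Write iota g = k a^t l^-1 with k, l in SO(2).  The points f k and f (k a^t)
    = rho g (f l) of Y are equal, so rho g maps a frame lifting f l to one
    lifting f k, up to a diagonal matrix; by the Anosov property, measured in an
    invariant norm, the successive ratios of the diagonal entries tend to 0 as t
    grows.  Along an ultrafilter escaping the finite subsets of the group, rho g
    and its inverse thus converge, up to scaling, to operators of rank one, whose
    images and kernels are read off f k and f l.  Replacing g by g^-1 exchanges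
    (k, l) with (l w, k w), w the Weyl element, which shows that all of them are
    points and lines of the limit curve.  A flag of Omega whose images remain in
    a compact subset of Omega would have its point in the kernel line and its
    line through the repelling point, which forces it to meet L or L^*: so the
    action is properly discontinuous, even for Gamma instead of rho(Gamma).

    No cocompactness is needed: a single continuous norm suffices, and one is
    built by averaging over the group with locally finite weights.

    Point stabilizers in Gamma are thus finite, hence trivial because Gamma is
    torsion-free: it has a presentation of the form
    < t, y, x_j | t y t^-1 = W(x)^-1 y^{+-1} >, so it is an extension of Z by the
    free group on y and the conjugates t^n x_j t^-n. *)

Set Implicit Arguments.
Unset Strict Implicit.
Unset Printing Implicit Defensive.

Import Order.TTheory GRing.Theory Num.Theory.
Import numFieldNormedType.Exports.

(** * Surface groups are torsion-free *)

Section MultiplicativeGroup.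
Variables (G G' : groupType) (h : {multiplicative G -> G'}).
Local Open Scope group_scope.

Lemma multiplicative1 : h 1 = 1.
Proof. by apply: (mulgI (h 1)); rewrite -gmulfM !mulg1. Qed.

Lemma multiplicativeV a : h a^-1 = (h a)^-1.
Proof. by apply: (mulgI (h a)); rewrite -gmulfM !mulgV multiplicative1. Qed.

Lemma multiplicativeX a n : h (a ^+ n) = h a ^+ n.
Proof. by elim: n => [|n IH]; rewrite ?multiplicative1// !expgS gmulfM IH. Qed.

End MultiplicativeGroup.

Section WordEval.
Variables (G : groupType) (I : Type) (x : I -> G).
Implicit Types w : word I.
Local Open Scope group_scope.

Lemma word_eval_nil : word_eval x [::] = 1.
Proof. by rewrite /word_eval big_nil. Qed.

Lemma word_eval_cons l w :
  word_eval x (l :: w) = (if l.2 then x l.1 else (x l.1)^-1) * word_eval x w.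
Proof. by rewrite /word_eval big_cons. Qed.

Lemma word_eval_cat w w' :
  word_eval x (w ++ w') = word_eval x w * word_eval x w'.
Proof. by rewrite /word_eval big_cat. Qed.

Lemma word_eval_presented r w w' :
  word_eval x r = 1 -> presented_eq r w w' -> word_eval x w = word_eval x w'.
Proof.
move=> r1; elim=> {w w'} [//|? ? _ ->//|? ? ? _ -> _ ->//|u w w' v _ ww'|i b|].
- by rewrite !word_eval_cat ww'.
- rewrite !word_eval_cons word_eval_nil mulg1 /=.
  by case: b => /=; rewrite ?mulgV ?mulVg.
- by rewrite r1 word_eval_nil.
Qed.

End WordEval.

Lemma word_eval_morph (G G' : groupType) (I : Type) (x : I -> G)
    (h : {multiplicative G -> G'}) w :
  h (word_eval x w) = word_eval (h \o x) w.
Proof.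
elim: w => [|l w IH]; first by rewrite !word_eval_nil multiplicative1.
by rewrite !word_eval_cons gmulfM IH; case: l.2; rewrite //= multiplicativeV.
Qed.

(** * Free groups as groups of reduced words *)

Section FreeGroup.
Variable S : eqType.
Implicit Types (l : S * bool) (u v w : seq (S * bool)).

Definition flip l := (l.1, ~~ l.2).

Lemma flipK : involutive flip.
Proof. by case=> s b; rewrite /flip /= negbK. Qed.

(** Left multiplication of a reduced word by a letter, [flip l] being the inverse letter. [pushK]
    makes it invertible, so that words act on reduced words by bijections and the group laws follow
    with no confluence argument. *)
Definition push l u :=
  if u is l' :: u' then if l' == flip l then u' else l :: u else [:: l].

Definition reduced u := sorted (fun l l' => l' != flip l) u.

Lemma reduced_push l u : reduced u -> reduced (push l u).
Proof.
case: u => //= l' u; case: eqP => [_ /path_sorted//|/eqP ne pu].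
by rewrite /= ne.
Qed.

Lemma pushK l u : reduced u -> push (flip l) (push l u) = u.
Proof.
case: u => [_|l' u] /=; first by rewrite flipK eqxx.
case: eqP => [->|_ _] /=; last by rewrite flipK eqxx.
by case: u => //= l'' u /andP[/negbTE ->].
Qed.

Definition reduce u := foldr push [::] u.

Lemma reduced_foldr u v : reduced v -> reduced (foldr push v u).
Proof. by move=> rv; elim: u => //= l u; exact: reduced_push. Qed.

Lemma reduced_reduce u : reduced (reduce u).
Proof. exact: reduced_foldr. Qed.

Lemma reduce_id u : reduced u -> reduce u = u.
Proof.
elim: u => //= l u IH pu; rewrite IH; last exact: path_sorted pu.
by case: u pu {IH} => //= l' u /andP[/negbTE ->].
Qed.

(** Cancelling a letter against its inverse inside [u] does not change the action of [u] on [v], by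
    [pushK]. Associativity of the product rests on this. *)
Lemma foldr_push_reduce u v :
  reduced v -> foldr push v (reduce u) = foldr push v u.
Proof.
move=> rv; elim: u => //= l u <-.
case: (reduce u) (reduced_reduce u) => //= l' u' _.
case: eqP => [->|//] /=.
by have := pushK (flip l) (reduced_foldr u' rv); rewrite flipK.
Qed.

Lemma reduce_cat u v : reduce (u ++ v) = foldr push (reduce v) u.
Proof. by rewrite /reduce foldr_cat. Qed.

Lemma reduce_cat_reduce u v : reduce (reduce u ++ v) = reduce (u ++ v).
Proof.
by rewrite !reduce_cat foldr_push_reduce//; exact: reduced_reduce.
Qed.

Lemma reduce_cat_reduce_r u v : reduce (u ++ reduce v) = reduce (u ++ v).
Proof. by rewrite !reduce_cat (reduce_id (reduced_reduce v)). Qed.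

Definition free_group := {u : seq (S * bool) | reduced u}.
HB.instance Definition _ := Choice.copy free_group {classic free_group}.

Definition free_of u : free_group := exist _ (reduce u) (reduced_reduce u).
Definition free_one : free_group := free_of [::].
Definition free_mul (a b : free_group) : free_group := free_of (sval a ++ sval b).
Definition free_inv (a : free_group) : free_group := free_of (rev (map flip (sval a))).

Lemma free_inj (a b : free_group) : sval a = sval b -> a = b.
Proof. by case: a b => [a ra] [b rb] /= ab; case: b / ab rb => rb; congr exist; exact: bool_irrelevance. Qed.

Lemma free_ofK (a : free_group) : free_of (sval a) = a.
Proof. by apply: free_inj; rewrite /= reduce_id//; case: a. Qed.

Lemma free_mulA : associative free_mul.
Proof.
move=> a b c; apply: free_inj => /=.
by rewrite reduce_cat_reduce reduce_cat_reduce_r catA.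
Qed.

Lemma free_mul1 : left_id free_one free_mul.
Proof. by move=> a; apply: free_inj; rewrite /= reduce_id//; case: a. Qed.

Lemma free_mulr1 : right_id free_one free_mul.
Proof. by move=> a; apply: free_inj; rewrite /= cats0 reduce_id//; case: a. Qed.

Lemma reduce_flip u : reduce (u ++ rev (map flip u)) = [::].
Proof.
elim: u => //= l u IH; rewrite rev_cons -cats1 catA.
by rewrite -reduce_cat_reduce IH /= eqxx.
Qed.

Lemma free_mulrV : right_inverse free_one free_inv free_mul.
Proof.
move=> a; apply: free_inj => /=.
by rewrite reduce_cat_reduce_r reduce_flip.
Qed.

Lemma free_mulV : left_inverse free_one free_inv free_mul.
Proof.
move=> a; apply: free_inj => /=; rewrite reduce_cat_reduce.
have := reduce_flip (rev (map flip (sval a))).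
by rewrite map_rev revK -map_comp (eq_map flipK) map_id.
Qed.

HB.instance Definition _ :=
  isGroup.Build free_group free_mulA free_mul1 free_mulr1 free_mulV free_mulrV.

Definition free_gen (s : S) : free_group := free_of [:: (s, true)].

Local Open Scope group_scope.

Lemma free_gen_letter l :
  free_of [:: l] = if l.2 then free_gen l.1 else (free_gen l.1)^-1.
Proof.
by case: l => s [].
Qed.

Lemma word_eval_free u : word_eval free_gen u = free_of u.
Proof.
elim: u => [|l u IH]; first by rewrite word_eval_nil.
rewrite word_eval_cons IH -free_gen_letter; apply: free_inj => /=.
by rewrite (reduce_id (reduced_reduce u)).
Qed.

Lemma free_of_cat u v : free_of (u ++ v) = free_of u * free_of v.
Proof.
by apply: free_inj; rewrite /= reduce_cat_reduce reduce_cat_reduce_r.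
Qed.

Lemma free_ofX u n : free_of u ^+ n = free_of (flatten (nseq n u)).
Proof. by elim: n => [//|n IH]; rewrite expgS IH /= free_of_cat. Qed.

(* Cyclic reduction: a reduced word is either a conjugate of a shorter one, or
   has reduced powers. *)
Lemma free_torsion_free (a : free_group) n : a ^+ n.+1 = 1 -> a = 1.
Proof.
have [m] := ubnP (size (sval a)); elim: m a => // m IH a am.
rewrite -[a]free_ofK free_ofX => an.
have ra : reduced (sval a) by case: (a).
case: (sval a) am an ra => [//|y u] am an ra.
have [yu|yu] := eqVneq y (flip (last y u)); last first.
  suff : reduced (flatten (nseq n.+1 (y :: u))).
    move/reduce_id => rn.
    by have : reduce (flatten (nseq n.+1 (y :: u))) = [::] := congr1 sval an; rewrite rn.
  have rep k : path (fun l l' => l' != flip l) (last y u) (flatten (nseq k (y :: u))).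
    by elim: k => //= k IHk; rewrite yu cat_path [path _ _ _]ra.
  by rewrite /reduced /= cat_path [path _ _ _]ra rep.
case: (lastP u) yu am an ra => [/= yE|v z].
  by have {yE} := congr1 snd yE => /=; case: (y.2).
rewrite last_rcons => -> am an ra.
have zz : free_of [:: z] = (free_of [:: flip z])^-1.
  by apply: (mulgI (free_of [:: flip z])); rewrite mulgV -free_of_cat;
     apply: free_inj; rewrite /= flipK eqxx.
have E : free_of (flip z :: rcons v z) =
    free_of [:: flip z] * free_of v * (free_of [:: flip z])^-1.
  by rewrite -zz -!free_of_cat -cats1.
suff v1 : free_of v = 1 by rewrite E v1 mulg1 mulgV.
have rv : reduced v.
  by move: ra; rewrite /reduced /= rcons_path => /andP[/path_sorted].
apply: IH; first by move: am; rewrite /= (reduce_id rv) size_rcons ltnS => /ltnW.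
move: an; rewrite -free_ofX E; set p := free_of [:: flip z].
rewrite -{1}[p]invgK -mulgA -conjgE -conjXg.
by move=> /(canRL (conjgK _)); rewrite conj1g.
Qed.

Section FreeLift.
Variables (K : groupType) (phi : S -> K).

Definition free_lift (a : free_group) : K := word_eval phi (sval a).

(** [push] either prepends a letter or cancels it against its inverse, and neither affects the value
    of the word. Multiplicativity of [free_lift] follows at once. *)
Lemma free_lift_of u : free_lift (free_of u) = word_eval phi u.
Proof.
rewrite /free_lift /=; elim: u => //= l u IH; rewrite word_eval_cons -IH.
case: (reduce u) => [|l' u'] /=; first by rewrite word_eval_cons.
case: eqP => [->|_]; last by rewrite word_eval_cons.
by rewrite word_eval_cons /=; case: l.2 => /=; rewrite ?mulKg ?mulVKg.
Qed.

Lemma free_liftM : {morph free_lift : a b / a * b}.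
Proof. by move=> a b; rewrite free_lift_of word_eval_cat. Qed.

HB.instance Definition _ := isMultiplicative.Build _ _ free_lift free_liftM.

Lemma free_lift_gen s : free_lift (free_gen s) = phi s.
Proof. by rewrite free_lift_of word_eval_cons word_eval_nil mulg1. Qed.

End FreeLift.

Lemma free_hom_ext (K : groupType) (h h' : {multiplicative free_group -> K}) :
  (forall s, h (free_gen s) = h' (free_gen s)) -> h =1 h'.
Proof.
move=> hh' a; rewrite -[a]free_ofK -word_eval_free !word_eval_morph.
by congr word_eval; apply/funext => s; exact: hh'.
Qed.

End FreeGroup.

Section Bijections.
Variable Z : Type.

(** Permutations of a type that may be infinite, the inverse being part of the data; a semidirect
    product is realized below inside such a group. *)
Record bij := Bij { fwd : Z -> Z; bwd : Z -> Z;
                    fwdK : cancel fwd bwd; bwdK : cancel bwd fwd }.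
HB.instance Definition _ := Choice.copy bij {classic bij}.

Lemma bij_inj a b : fwd a =1 fwd b -> a = b.
Proof.
case: a b => f f' fK f'K [g g' gK g'K] /= fg.
have E : f = g by exact/funext.
subst g; have E' : f' = g'.
  by apply/funext => z; rewrite -{1}(g'K z) fK.
by subst g'; congr Bij; exact: Prop_irrelevance.
Qed.

Definition bij_one := @Bij id id (fun=> erefl) (fun=> erefl).
Definition bij_mul a b := Bij (can_comp (fwdK a) (fwdK b)) (can_comp (bwdK b) (bwdK a)).
Definition bij_inv a := Bij (bwdK a) (fwdK a).

Lemma bij_mulA : associative bij_mul.
Proof. by move=> a b c; exact: bij_inj. Qed.
Lemma bij_mul1 : left_id bij_one bij_mul.
Proof. by move=> a; exact: bij_inj. Qed.
Lemma bij_mulr1 : right_id bij_one bij_mul.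
Proof. by move=> a; exact: bij_inj. Qed.
Lemma bij_mulV : left_inverse bij_one bij_inv bij_mul.
Proof. by move=> a; apply: bij_inj => z; exact: fwdK. Qed.
Lemma bij_mulrV : right_inverse bij_one bij_inv bij_mul.
Proof. by move=> a; apply: bij_inj => z; exact: bwdK. Qed.

HB.instance Definition _ :=
  isGroup.Build bij bij_mulA bij_mul1 bij_mulr1 bij_mulV bij_mulrV.

End Bijections.

Section PresentationHom.
Variables (G : groupType) (I : Type) (r : word I) (x : I -> G).
Hypothesis x_gen : forall g, exists w, word_eval x w = g.
Hypothesis x_rel : forall w, word_eval x w = 1%g <-> presented_eq r w [::].
Local Open Scope group_scope.

Lemma relator_eval1 : word_eval x r = 1.
Proof. by apply/x_rel; constructor. Qed.

(** Von Dyck: words with equal values in [G] differ by consequences of [r], so evaluation at [X]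
    factors through [G]. *)
Lemma presentation_hom (P : groupType) (X : I -> P) :
  word_eval X r = 1 -> exists h : {multiplicative G -> P}, h \o x = X.
Proof.
move=> Xr; pose W g := sval (cid (x_gen g)).
have WK g : word_eval x (W g) = g by rewrite /W; case: cid.
have wd w w' : word_eval x w = word_eval x w' -> word_eval X w = word_eval X w'.
  (* The formal inverse of [w']: [x_rel] only speaks of words of value 1, so [w] and [w'] are
     compared through [w ++ u]. *)
  pose u := rev [seq (l.1, ~~ l.2) | l <- w'].
  have uK (Q : groupType) (q : I -> Q) : word_eval q (w' ++ u) = 1.
    rewrite {}/u; elim: w' => [|l w' IH]; first exact: word_eval_nil.
    rewrite /= rev_cons -cats1 word_eval_cons catA word_eval_cat IH mul1g.
    by rewrite word_eval_cons word_eval_nil mulg1 /=; case: l.2; rewrite ?mulgV ?mulVg.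
  move=> ww'; apply: (mulIg (word_eval X u)).
  have /x_rel/(word_eval_presented Xr) : word_eval x (w ++ u) = 1.
    by rewrite word_eval_cat ww' -word_eval_cat uK.
  by rewrite word_eval_nil -!word_eval_cat uK.
pose h g := word_eval X (W g).
have hM : {morph h : a b / a * b}.
  by move=> a b; rewrite /h -word_eval_cat; apply: wd; rewrite word_eval_cat !WK.
pose hm := isMultiplicative.Build G P h hM.
pose hh : {multiplicative G -> P} := HB.pack h hm.
exists hh; apply/funext => i; rewrite /= /h.
have -> : X i = word_eval X [:: (i, true)].
  by rewrite word_eval_cons word_eval_nil mulg1.
by apply: wd; rewrite WK word_eval_cons word_eval_nil mulg1.
Qed.

End PresentationHom.

(** * Extensions of Z by a free group *)

Section CyclicExtension.
Variables (J : choiceType) (W : word J) (eps : bool).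
Local Open Scope group_scope.

(** [eps] is true for orientable surfaces and false for non-orientable ones, where conjugation by t
    inverts y modulo the normal closure of the x_j. *)
Definition twist (G : groupType) (y : G) := if eps then y else y^-1.

Lemma twist_morph (G G' : groupType) (h : {multiplicative G -> G'}) y :
  h (twist y) = twist (h y).
Proof.
by rewrite /twist; case: eps => //; exact: multiplicativeV.
Qed.

(** Free generators of the kernel of the degree in t: [Some (j, n)] stands for t^n x_j t^-n and
    [None] for y. *)
Local Notation S := (option (J * int)%type).
Local Notation F := (free_group S).
Let chi (n : int) (j : J) : F := free_gen (Some (j, n)).
Let y0 : F := free_gen None.

(** Conjugation by t, prescribed on y by the relation t y t^-1 = W(x)^-1 y^{+-1}; [unshift_gen]
    solves the same relation for t^-1 y t. *)
Let shift_gen (s : S) : F :=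
  if s is Some (j, n) then chi (n + 1)%R j
  else (word_eval (chi 0) W)^-1 * twist y0.
Let unshift_gen (s : S) : F :=
  if s is Some (j, n) then chi (n - 1)%R j
  else twist (word_eval (chi (-1)) W * y0).
Let sigma : {multiplicative F -> F} := free_lift shift_gen.
Let sigma' : {multiplicative F -> F} := free_lift unshift_gen.

Let sigma_gen s : sigma (free_gen s) = shift_gen s.
Proof. exact: free_lift_gen. Qed.
Let sigma'_gen s : sigma' (free_gen s) = unshift_gen s.
Proof. exact: free_lift_gen. Qed.


Let sigma_chi n : sigma \o chi n = chi (n + 1)%R.
Proof. by apply/funext => j; exact: sigma_gen. Qed.
Let sigma'_chi n : sigma' \o chi n = chi (n - 1)%R.
Proof. by apply/funext => j; exact: sigma'_gen. Qed.

Lemma sigmaK : cancel sigma sigma'.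
Proof.
move=> a; apply: (free_hom_ext (h := sigma' \o sigma) (h' := idfun)) => s.
change (sigma' (sigma (free_gen s)) = free_gen s).
rewrite sigma_gen; case: s => [[j n]|] /=; first by rewrite sigma'_gen /= addrK.
rewrite gmulfM multiplicativeV word_eval_morph sigma'_chi sub0r twist_morph sigma'_gen /=.
by rewrite /twist; case: eps; rewrite ?invgK mulKg.
Qed.

Lemma sigma'K : cancel sigma' sigma.
Proof.
move=> a; apply: (free_hom_ext (h := sigma \o sigma') (h' := idfun)) => s.
change (sigma (sigma' (free_gen s)) = free_gen s).
rewrite sigma'_gen; case: s => [[j n]|] /=; first by rewrite sigma_gen /= subrK.
rewrite twist_morph gmulfM word_eval_morph sigma_chi addNr sigma_gen /=.
by rewrite mulVKg /twist; case: eps; rewrite ?invgK.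
Qed.

(** The pair (a, n) stands for a t^n in the semidirect product of [F] by the integers. [tau] and
    [ltrans a] are the left multiplications by t and by a, so that the product acts on its
    underlying set without being built as a group. *)
Local Notation Z := (F * int)%type.

Lemma tau_fwdK : cancel (fun z : Z => (sigma z.1, (z.2 + 1)%R))
                        (fun z : Z => (sigma' z.1, (z.2 - 1)%R)).
Proof. by case=> a n /=; rewrite sigmaK addrK. Qed.
Lemma tau_bwdK : cancel (fun z : Z => (sigma' z.1, (z.2 - 1)%R))
                        (fun z : Z => (sigma z.1, (z.2 + 1)%R)).
Proof. by case=> a n /=; rewrite sigma'K subrK. Qed.
Let tau : bij Z := Bij tau_fwdK tau_bwdK.

Lemma ltrans_fwdK a : cancel (fun z : Z => (a * z.1, z.2))
                              (fun z : Z => (a^-1 * z.1, z.2)).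
Proof. by case=> b n /=; rewrite mulKg. Qed.
Lemma ltrans_bwdK a : cancel (fun z : Z => (a^-1 * z.1, z.2))
                              (fun z : Z => (a * z.1, z.2)).
Proof. by case=> b n /=; rewrite mulVKg. Qed.
Definition ltrans a : bij Z := Bij (ltrans_fwdK a) (ltrans_bwdK a).

Lemma ltransM : {morph ltrans : a b / a * b}.
Proof. by move=> a b; apply: bij_inj => -[c n] /=; rewrite mulgA. Qed.
HB.instance Definition _ := isMultiplicative.Build _ _ ltrans ltransM.

Lemma tau_ltrans a : tau * ltrans a * tau^-1 = ltrans (sigma a).
Proof.
apply: bij_inj => -[c n]; rewrite /= /comp /=.
by rewrite gmulfM sigma'K subrK.
Qed.


Section TorsionFree.
Variables (G : groupType) (t y : G) (x : J -> G).
(** The presentation of [G] enters in three forms: its relation, generation as an induction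
    principle, and the universal property. *)
Hypothesis G_rel : t * y * t^-1 = (word_eval x W)^-1 * twist y.
Hypothesis G_ind : forall D : G -> Prop, D 1 ->
  (forall g h, h \in [:: t; y] \/ (exists j, h = x j) ->
     D g -> D (h * g) /\ D (h^-1 * g)) -> forall g, D g.
Hypothesis G_hom : forall (P : groupType) (t' y' : P) (x' : J -> P),
  t' * y' * t'^-1 = (word_eval x' W)^-1 * twist y' ->
  exists h : {multiplicative G -> P}, [/\ h t = t', h y = y' & h \o x = x'].

Let tz (n : int) : G := match n with Posz k => t ^+ k | Negz k => t ^- k.+1 end.

Let tzS n : tz (n + 1)%R = t * tz n.
Proof.
case: n => [k|[|k]].
- by rewrite addrC -intS /= expgS.
- by rewrite /= mulgV.
- have -> : (Negz k.+1 + 1)%R = Negz k by rewrite !NegzE [Posz k.+2]intS opprD addrAC addNr add0r.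
  by rewrite /= [t ^+ k.+2]expgSr invgM mulVKg.
Qed.

Let base_gen (s : S) : G :=
  if s is Some (j, n) then tz n * x j * (tz n)^-1 else y.
Let base : {multiplicative F -> G} := free_lift base_gen.

(** Both sides are morphisms in [a], so generators suffice: the shift of the index is absorbed by
    [tzS], and on y the claim is [G_rel]. *)
Let base_sigma a : base (sigma a) = t * base a * t^-1.
Proof.
have -> : t * base a * t^-1 = base a ^ t^-1 by rewrite conjgE invgK mulgA.
have cM : {morph (fun g => g ^ t^-1) : a b / a * b} by move=> b c; exact: conjMg.
pose cm := isMultiplicative.Build G G _ cM.
pose c : {multiplicative G -> G} := HB.pack (fun g => g ^ t^-1) cm.
apply: (free_hom_ext (h := base \o sigma) (h' := c \o base)) => s.
change (base (sigma (free_gen s)) = base (free_gen s) ^ t^-1).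
rewrite sigma_gen conjgE invgK mulgA.
have base_free u : base (free_gen u) = base_gen u by exact: free_lift_gen.
rewrite base_free.
case: s => [[j n]|] /=; first by rewrite base_free /= tzS !invgM !mulgA.
rewrite G_rel gmulfM twist_morph base_free /=; congr (_ * _).
rewrite multiplicativeV word_eval_morph; congr (word_eval _ W)^-1.
apply/funext => j; rewrite -[LHS]/(base (free_gen (Some (j, 0%R)))) base_free.
by rewrite -[base_gen _]/(1 * x j * 1^-1) mul1g invg1 mulg1.
Qed.


Let ev (z : Z) : G := base z.1 * tz z.2.

(** [G] acts on pairs through [h], and [ev] is equivariant. A torsion element has degree 0 in t,
    hence comes from some [u] in the free group; it acts as left translation by [u], so [u] is
    torsion too. *)
Lemma cyclic_extension_torsion_free (g : G) n : g ^+ n.+1 = 1 -> g = 1.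
Proof.
have rel : tau * ltrans y0 * tau^-1 =
    (word_eval (ltrans \o chi 0) W)^-1 * twist (ltrans y0).
  rewrite tau_ltrans sigma_gen /= gmulfM twist_morph -word_eval_morph.
  by rewrite multiplicativeV.
have [h [ht hy hx]] := G_hom rel.
have hV a : h a^-1 = (h a)^-1 := multiplicativeV h a.
have h1 : h 1 = 1 := multiplicative1 h.
have base1 : base 1 = 1 := multiplicative1 base.
have base_free u : base (free_gen u) = base_gen u by exact: free_lift_gen.
have evV a : (forall z, ev (fwd (h a) z) = a * ev z) ->
    forall z, ev (fwd (h a^-1) z) = a^-1 * ev z.
  move=> ea z; apply: (mulgI a); rewrite -ea hV mulVKg /=.
  by rewrite bwdK.
have evE a z : ev (fwd (h a) z) = a * ev z.
  elim/G_ind: a z => [z|a b ab IH]; first by rewrite h1 mul1g.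
  suff eb : forall z, ev (fwd (h b) z) = b * ev z.
    by split=> z; rewrite gmulfM -[LHS]/(ev (fwd _ (fwd (h a) z))) ?evV ?eb ?IH ?mulgA.
  case: ab => [|[j ->] z]; first rewrite !inE => /orP[]/eqP -> z.
  - by rewrite ht /ev /= base_sigma tzS !mulgA divgK.
  - by rewrite hy /ev /= gmulfM base_free mulgA.
  - rewrite -[h (x j)]/((h \o x) j) hx /ev /= gmulfM base_free /=.
    by rewrite -[t ^+ 0]/(1 : G) mul1g invg1 mulg1 mulgA.
(* The shift of the second coordinate is the exponent sum in t. *)
have degE a : exists c : int, forall z, (fwd (h a) z).2 = (c + z.2)%R.
  elim/G_ind: a => [|a b ab [c IH]].
    by exists 0%R => z; rewrite h1 add0r.
  have [d db] : exists d, forall z, (fwd (h b) z).2 = (d + z.2)%R.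
    case: ab => [|[j ->]]; first rewrite !inE => /orP[]/eqP ->.
    - by exists 1%R => z; rewrite ht /= addrC.
    - by exists 0%R => z; rewrite hy /= add0r.
    - by exists 0%R => z; rewrite -[h (x j)]/((h \o x) j) hx /= add0r.
  split; first by exists (d + c)%R => z; rewrite gmulfM /= db IH addrA.
  exists (- d + c)%R => z; rewrite gmulfM hV -[RHS]addrA -IH /=.
  by rewrite -{2}(bwdK (h b) (fwd (h a) z)) db addKr.
move=> gn; have [c cg] := degE g.
have cX k z : (fwd (h (g ^+ k)) z).2 = (c *+ k + z.2)%R.
  by elim: k z => [|k IH] z; rewrite ?expg0 ?h1 ?add0r// expgS gmulfM /= cg IH mulrS addrA.
have c0 : c = 0%R.
  have : (c *+ n.+1 = 0)%R by rewrite -[LHS]addr0 -[LHS](cX n.+1 (1, 0%R)) gn h1.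
  by move/eqP; rewrite mulrn_eq0 => /eqP.
(* As [ev (1, 0)] is 1, equivariance recovers [g] from the image of this base point. *)
pose u := (fwd (h g) (1, 0%R)).1.
have gE : g = base u.
  have := evE g (1, 0%R); rewrite /ev cg c0 add0r -[tz _]/(1 : G).
  by rewrite [base (1, _).1]base1 !mulg1.
(* This makes [base] injective: [h] undoes it up to the faithful action by left translations. *)
have hbase a : h (base a) = ltrans a.
  apply: (free_hom_ext (h := h \o base)) => -[[j m]|]; last first.
    by change (h (base (free_gen None)) = ltrans y0); rewrite base_free.
  change (h (base (free_gen (Some (j, m)))) = ltrans (chi m j)).
  rewrite base_free /= !gmulfM hV -[h (x j)]/((h \o x) j) hx /=.
  have tauz k : h (tz k) * ltrans (chi 0 j) * (h (tz k))^-1 = ltrans (chi k j).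
    have tauS k' : tau * ltrans (chi k' j) * tau^-1 = ltrans (chi (k' + 1)%R j).
      by rewrite tau_ltrans sigma_gen.
    have step k' : h (tz (k' + 1)%R) = tau * h (tz k') by rewrite tzS gmulfM ht.
    elim/int_ind: k => [|k IH|k IH]; first by rewrite /= h1 mul1g invg1 mulg1.
      by rewrite intS addrC step invgM -tauS -IH !mulgA.
    have kE : (- Posz k.+1 + 1 = - Posz k)%R.
      by rewrite intS opprD addrAC addNr add0r.
    apply: (mulgI tau); apply: (mulIg tau^-1).
    by rewrite [RHS]tauS kE -IH -kE step invgM !mulgA.
  exact: tauz.
have : u ^+ n.+1 = 1.
  have : ltrans (u ^+ n.+1) = 1.
    rewrite -hbase; have -> : base (u ^+ n.+1) = g ^+ n.+1.
      by rewrite gE multiplicativeX.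
    by rewrite gn h1.
  by move=> /(congr1 (fun b => (fwd b (1, 0%R)).1)) /=; rewrite mulg1.
by move=> /free_torsion_free u1; rewrite gE u1 base1.
Qed.

End TorsionFree.
End CyclicExtension.

Lemma word_eval_map (G : groupType) (I J : Type) (x : J -> G) (f : I -> J) w :
  word_eval x [seq (f l.1, l.2) | l <- w] = word_eval (x \o f) w.
Proof. by rewrite /word_eval big_map. Qed.

(** * Surface groups as cyclic extensions of free groups *)

Section SurfaceGroups.
Variable G : groupType.
Local Open Scope group_scope.

Lemma word_eval_ind (I : Type) (x : I -> G) (D : G -> Prop) : D 1 ->
  (forall i g, D g -> D (x i * g) /\ D ((x i)^-1 * g)) ->
  forall w, D (word_eval x w).
Proof.
move=> D1 DM; elim=> [|[i b] w IH]; first by rewrite word_eval_nil.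
by rewrite word_eval_cons /=; case: b; case: (DM i _ IH).
Qed.

(** With R the product of the other commutators, a b a^-1 b^-1 R = 1 reads a b a^-1 = R^-1 b: take t
    = a and y = b for the first pair of generators. *)
Lemma orientable_torsion_free k (a : G) n :
  has_presentation G (orientable_relator k.+1) -> a ^+ n.+1 = 1 -> a = 1.
Proof.
case=> x [x_gen x_rel]; pose f (i : 'I_k * bool) := (lift ord0 i.1, i.2).
have relE (P : groupType) (X : 'I_k.+1 * bool -> P) :
    word_eval X (orientable_relator k.+1) =
    X (ord0, false) * X (ord0, true) * (X (ord0, false))^-1 * (X (ord0, true))^-1 *
    word_eval (X \o f) (orientable_relator k).
  rewrite -word_eval_map {1}/orientable_relator enum_ordSl /= !word_eval_cons /=.
  rewrite !mulgA; congr (_ * word_eval X _).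
  rewrite /orientable_relator map_flatten -!map_comp; congr flatten.
have r1 := relator_eval1 x_rel; rewrite relE in r1.
apply: (@cyclic_extension_torsion_free _ (orientable_relator k) true G
  (x (ord0, false)) (x (ord0, true)) (x \o f)).
- apply: (mulIg (x (ord0, true))^-1); rewrite /twist mulgK.
  by apply: (mulIg (word_eval (x \o f) (orientable_relator k))); rewrite r1 mulVg.
- move=> D D1 DM g; have [w <-] := x_gen g.
  apply: word_eval_ind => // -[i b] h; apply: DM.
  have [j ->|i0] := unliftP ord0 i; first by right; exists (j, b).
  by left; rewrite i0 !inE; case: b; rewrite eqxx ?orbT.
- move=> P t y X rel.
  pose X' (i : 'I_k.+1 * bool) : P :=
    if unlift ord0 i.1 is Some j then X (j, i.2) else if i.2 then y else t.
  have Xf : X' \o f = X by apply/funext => -[j b]; rewrite /X' /= liftK.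
  have X0 b : X' (ord0, b) = if b then y else t by rewrite /X' unlift_none.
  have [|h hx] := presentation_hom x_gen x_rel (X := X').
    by rewrite relE Xf !X0 rel /twist mulgK mulVg.
  exists h; split.
  + by rewrite -[LHS]/((h \o x) _) hx X0.
  + by rewrite -[LHS]/((h \o x) _) hx X0.
  + by rewrite compA hx.
Qed.

(** From c_1^2 c_2^2 R = 1, the choice t = c_1 and y = c_1 c_2 gives t y t^-1 = c_1^2 c_2^2 y^-1 =
    R^-1 y^-1. *)
Lemma nonorientable_torsion_free k (a : G) n :
  has_presentation G (nonorientable_relator k.+2) -> a ^+ n.+1 = 1 -> a = 1.
Proof.
case=> x [x_gen x_rel].
pose o1 : 'I_k.+2 := lift ord0 ord0.
pose f (i : 'I_k) : 'I_k.+2 := lift ord0 (lift ord0 i).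
have relE (P : groupType) (X : 'I_k.+2 -> P) :
    word_eval X (nonorientable_relator k.+2) =
    X ord0 * X ord0 * X o1 * X o1 * word_eval (X \o f) (nonorientable_relator k).
  rewrite -word_eval_map {1}/nonorientable_relator !enum_ordSl /= !word_eval_cons /=.
  rewrite !mulgA; congr (_ * word_eval X _).
  rewrite /nonorientable_relator map_flatten -!map_comp; congr flatten.
have r1 := relator_eval1 x_rel; rewrite relE in r1.
have indG (D : G -> Prop) : D 1 ->
    (forall g i, D g -> D (x i * g) /\ D ((x i)^-1 * g)) -> forall g, D g.
  by move=> D1 DM g; have [w <-] := x_gen g; apply: word_eval_ind => // i h; exact: DM.
apply: (@cyclic_extension_torsion_free _ (nonorientable_relator k) false G
  (x ord0) (x ord0 * x o1) (x \o f)).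
- apply: (mulIg (x ord0 * x o1)); rewrite /twist mulgVK.
  apply: (mulIg (word_eval (x \o f) (nonorientable_relator k))).
  by rewrite mulVg -[RHS]r1 !mulgA mulgVK.
- move=> D D1 DM; apply: indG => // g i Dg.
  have [j ->|->] := unliftP ord0 i; last by apply: DM => //; left; rewrite inE eqxx.
  have [l ->|->] := unliftP ord0 j; first by apply: DM => //; right; exists l.
  have DM0 h : D h -> D (x ord0 * h) /\ D ((x ord0)^-1 * h).
    by apply: DM; left; rewrite inE eqxx.
  have DM1 h : D h -> D (x ord0 * x o1 * h) /\ D ((x ord0 * x o1)^-1 * h).
    by apply: DM; left; rewrite !inE eqxx orbT.
  split.
    have [/DM0[_]] := DM1 g Dg; by rewrite -!mulgA mulKg.
  have [/DM1[_]] := DM0 g Dg; by rewrite invgM mulgA mulgVK.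
- move=> P t y X rel.
  (* The change of generators is undone by c_2 = t^-1 y. *)
  pose X' (i : 'I_k.+2) : P :=
    if unlift ord0 i is Some j then
      if unlift ord0 j is Some l then X l else t^-1 * y
    else t.
  have Xf : X' \o f = X by apply/funext => j; rewrite /X' /= !liftK.
  have X0 : X' ord0 = t by rewrite /X' unlift_none.
  have X1 : X' o1 = t^-1 * y by rewrite /X' liftK unlift_none.
  have [|h hx] := presentation_hom x_gen x_rel (X := X').
    rewrite relE Xf X0 X1 !mulgA mulgK.
    by rewrite rel /twist mulgVK mulVg.
  exists h; split.
  + by rewrite -[LHS]/((h \o x) _) hx X0.
  + by rewrite gmulfM -[h (x ord0)]/((h \o x) _) -[h (x o1)]/((h \o x) _) hx X0 X1 mulVKg.
  + by rewrite compA hx.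
Qed.

Lemma surface_group_torsion_free (a : G) n :
  negative_closed_surface_group G -> a ^+ n.+1 = 1 -> a = 1.
Proof.
case=> -[[|[|k]] // _]; first exact: orientable_torsion_free.
exact: nonorientable_torsion_free.
Qed.

End SurfaceGroups.

Local Open Scope classical_set_scope.
Local Open Scope ring_scope.

(** * Limits of matrices along filters *)

Section Ultrafilters.
Variable T : Type.

(** Sets containing all but finitely many points of [S] form a filter, proper because [S] is
    infinite; any ultrafilter above it works. *)
Lemma infinite_ultrafilter (S : set T) : infinite_set S ->
  exists U : set_system T, [/\ UltraFilter U, U S &
    forall B, finite_set B -> U (~` B)].
Proof.
move=> S_inf; pose F : set_system T := [set A | finite_set (S `\` A)].
have FF : ProperFilter F.
  apply: Build_ProperFilter.
    by rewrite /F /= setD0.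
  split.
  - by rewrite /F /= setDT; exact: finite_set0.
  - by move=> A B; rewrite /F /= setDIr finite_setU.
  - by move=> A B AB; apply: sub_finite_set => x [Sx nBx]; split => // /AB.
have [U [UU FU]] := ultraFilterLemma FF; exists U; split => //.
  by apply: FU; rewrite /F /= setDv; exact: finite_set0.
by move=> B Bfin; apply: FU; rewrite /F /= setDE setCK; exact: finite_setIr.
Qed.

Lemma fmap_ultrafilter (T' : Type) (f : T -> T') (F : set_system T) :
  UltraFilter F -> UltraFilter (f @ F).
Proof.
move=> FU; split=> [|G GF FG]; first exact: fmap_proper_filter.
apply/seteqP; split=> // A GA.
have [//|nA] := in_ultra_setVsetC (f @^-1` A) FU.
have /FG GnA : (f @ F) (~` A) by [].
by have [x []] := filter_ex (filterI GA GnA).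
Qed.

(** Compactness of a segment. Limits along an ultrafilter replace the extraction of subsequences
    throughout. *)
Lemma ultrafilter_bounded_cvg (R : realType) (F : set_system T) (f : T -> R) C :
  UltraFilter F -> (\forall x \near F, `|f x| <= C) -> exists l : R, f @ F --> l.
Proof.
move=> FU fC; have := @segment_compact R (- C) C; rewrite compact_ultra.
move=> /(_ (f @ F) (fmap_ultrafilter f FU)) -[|l [_ fl]]; last by exists l.
by apply: filterS fC => x /=; rewrite in_itv /= ler_norml.
Qed.

End Ultrafilters.

Section MatrixLimits.
Variables (R : realType) (T : Type) (F : set_system T).
Context {FF : Filter F}.

Lemma cvg_mxP m n (X : T -> 'M[R]_(m, n)) (A : 'M[R]_(m, n)) :
  X @ F --> A <-> forall i j, X x i j @[x --> F] --> A i j.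
Proof.
split=> [XA i j|XA].
  exact: (cvg_comp _ _ XA (@coord_continuous R m n i j A)).
move=> B [P PA PB]; rewrite /nbhs /=.
have : \forall x \near F, forall ij : 'I_m * 'I_n, P ij.1 ij.2 (X x ij.1 ij.2).
  by apply: filter_forall => ij; exact: XA.
by apply: filterS => x Px; apply: PB => i j; exact: (Px (i, j)).
Qed.

Lemma cvg_mulmx m n p (X : T -> 'M[R]_(m, n)) (Y : T -> 'M[R]_(n, p))
    (A : 'M[R]_(m, n)) (B : 'M[R]_(n, p)) :
  X @ F --> A -> Y @ F --> B -> X x *m Y x @[x --> F] --> A *m B.
Proof.
move=> /cvg_mxP XA /cvg_mxP YB; apply/cvg_mxP => i k.
rewrite mxE; under eq_fun do rewrite mxE.
apply: cvg_big => [|j _]; first exact: add_continuous.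
by apply: cvgM; [exact: XA|exact: YB].
Qed.

Lemma cvg_det n (X : T -> 'M[R]_n) (A : 'M[R]_n) :
  X @ F --> A -> \det (X x) @[x --> F] --> \det A.
Proof.
move=> /cvg_mxP XA; apply: cvg_big => [|s _]; first exact: add_continuous.
apply: cvgM; first exact: cvg_cst.
by apply: cvg_big => [|i _]; [exact: mul_continuous|exact: XA].
Qed.

Lemma cvg_adj n (X : T -> 'M[R]_n) (A : 'M[R]_n) :
  X @ F --> A -> \adj (X x) @[x --> F] --> \adj A.
Proof.
move=> /cvg_mxP XA; apply/cvg_mxP => i j; rewrite mxE.
under eq_fun do rewrite mxE.
apply: cvgM; first exact: cvg_cst.
apply: cvg_det; apply/cvg_mxP => k l; rewrite !mxE.
by under eq_fun do rewrite !mxE; exact: XA.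
Qed.

Lemma cvg_invmx n (X : T -> 'M[R]_n) (A : 'M[R]_n) : (forall x, X x \in unitmx) ->
  A \in unitmx -> X @ F --> A -> invmx (X x) @[x --> F] --> invmx A.
Proof.
move=> XU AU XA; rewrite {2}/invmx AU; under eq_fun do rewrite /invmx XU.
apply: cvgZ; last exact: cvg_adj.
apply: cvgV; first by rewrite -unitfE -unitmxE.
exact: cvg_det.
Qed.

Lemma cvg_col m n (X : T -> 'M[R]_(m, n)) (A : 'M[R]_(m, n)) j :
  X @ F --> A -> col j (X x) @[x --> F] --> col j A.
Proof.
move=> /cvg_mxP XA; apply/cvg_mxP => i k; rewrite mxE.
by under eq_fun do rewrite mxE; exact: XA.
Qed.

Lemma cvg_initial (S : topologicalType) (A : set S) (X : T -> A) (a : A) :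
  X @ F --> a <-> (fun x => val (X x)) @ F --> val a.
Proof.
split=> Xa.
  by apply: cvg_comp Xa _; exact: (@initial_continuous A S set_val).
move=> B [? [[C oC <-] Ca CB]]; apply: (filterS CB).
by apply: Xa; exact: open_nbhs_nbhs.
Qed.

End MatrixLimits.

Lemma ultrafilter_mx_cvg (R : realType) (T : Type) (F : set_system T) m n
    (X : T -> 'M[R]_(m, n)) C :
  UltraFilter F -> (\forall x \near F, forall i j, `|X x i j| <= C) ->
  exists A : 'M[R]_(m, n), X @ F --> A.
Proof.
move=> FU XC; have ex i j : exists l : R, X x i j @[x --> F] --> l.
  by apply: (@ultrafilter_bounded_cvg _ _ _ _ C); apply: filterS XC => x.
exists (\matrix_(i, j) sval (cid (ex i j))); apply/cvg_mxP => i j.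
by rewrite mxE; case: cid.
Qed.

Lemma continuous_val (S : topologicalType) (A : set S) : continuous (val : A -> S).
Proof. exact: (@initial_continuous A S set_val). Qed.

Section SLTopology.
Variables (R : realType) (n : nat).

Lemma cvg_SL_mul (T : Type) (F : set_system T) {FF : Filter F}
    (X Y : T -> SL R n) (a b : SL R n) :
  X @ F --> a -> Y @ F --> b -> (X x * Y x)%g @[x --> F] --> (a * b)%g.
Proof. by move=> /cvg_initial Xa /cvg_initial Yb; apply/cvg_initial; exact: cvg_mulmx. Qed.

Lemma cvg_SL_inv (T : Type) (F : set_system T) {FF : Filter F}
    (X : T -> SL R n) (a : SL R n) :
  X @ F --> a -> (X x)^-1%g @[x --> F] --> a^-1%g.
Proof.
move=> /cvg_initial Xa; apply/cvg_initial.
by apply: cvg_invmx => //; first (move=> x; exact: SL_unitmx); exact: SL_unitmx.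
Qed.

End SLTopology.

(** The norm is the largest absolute value of an entry, so a product costs the inner dimension as a
    factor. *)
Lemma mxnorm_mulmx (R : realType) m n p (A : 'M[R]_(m.+1, n.+1)) (B : 'M[R]_(n.+1, p.+1)) :
  `|A *m B| <= n.+1%:R * `|A| * `|B|.
Proof.
rewrite [leLHS]/Num.norm /= mx_normrE; apply: bigmax_le => [|[i k] _] /=.
  by rewrite !mulr_ge0.
rewrite mxE; apply: le_trans (ler_norm_sum _ _ _) _.
have -> : n.+1%:R * `|A| * `|B| = \sum_(j < n.+1) `|A| * `|B|.
  by rewrite sumr_const card_ord -mulrA mulr_natl.
apply: ler_sum => j _.
have le_norm q r (M : 'M[R]_(q, r)) x y : `|M x y| <= `|M|.
  by rewrite [leRHS]/Num.norm /= mx_normrE; exact: (le_bigmax _ _ (x, y)).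
by rewrite normrM ler_pM.
Qed.

(** * Projective spaces, frames and flags *)

(** Openness is tested on the preimage in [T]. If [y] is identified with [x] in [U], then the
    preimage of [U] by [psi] is a neighbourhood of [y] all of whose points are identified with
    points of [U]. *)
Lemma orbit_class_open (T : topologicalType) (orb : T -> set T) (U : set T) :
  (forall x y, orbit_class orb x = orbit_class orb y -> exists psi : T -> T,
     [/\ continuous psi, psi y = x &
         forall z, orbit_class orb (psi z) = orbit_class orb z]) ->
  open U -> open (orbit_class orb @` U).
Proof.
move=> H oU; rewrite /open /= /quotient_open openE => y [x Ux /H[psi [cpsi px pz]]].
have : nbhs y (psi @^-1` U).
  by apply: cpsi; rewrite px; exact: open_nbhs_nbhs.
by apply: filterS => z Uz; exists (psi z) => //; exact: pz.
Qed.

Lemma orbit_class_nbhs (T : topologicalType) (orb : T -> set T) x (U : set T) :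
  (forall x y, orbit_class orb x = orbit_class orb y -> exists psi : T -> T,
     [/\ continuous psi, psi y = x &
         forall z, orbit_class orb (psi z) = orbit_class orb z]) ->
  nbhs x U -> nbhs (orbit_class orb x) (orbit_class orb @` U).
Proof.
move=> H; rewrite nbhsE => -[V [oV Vx] VU].
apply: filterS (image_subset _ VU) _; apply: open_nbhs_nbhs; split; last by exists x.
exact: orbit_class_open.
Qed.

Lemma invmx_mul (R : comUnitRingType) n (A B : 'M[R]_n) :
  A \in unitmx -> B \in unitmx -> invmx (A *m B) = invmx B *m invmx A.
Proof.
move=> AU BU; have ABU : A *m B \in unitmx by rewrite unitmx_mul AU.
by apply: (can_inj (mulKmx ABU)); rewrite mulmxV// mulmxA mulmxK// mulmxV.
Qed.

Section Proj.
Variables (R : realType) (m n : nat).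
Local Notation E := 'M[R]_(m.+1, n.+1).
Implicit Types u v : E.

Lemma pclassP u v : u != 0 -> v != 0 ->
  (pclass u = pclass v :> Defs.proj R m n) <-> exists2 c : R, c != 0 & v = c *: u.
Proof.
move=> u0 v0; split=> [uv|[c c0 ->]]; last by rewrite pclassZ.
have [a a0 ua] := prepr_pclass u0; have [b b0 vb] := prepr_pclass v0.
exists (b^-1 * a); first by rewrite mulf_neq0 ?invr_eq0.
by rewrite -scalerA -ua uv vb scalerA mulVf ?scale1r.
Qed.

Lemma cvg_pclass (T : Type) (F : set_system T) {FF : Filter F} (X : T -> E) u :
  X @ F --> u -> u != 0 -> pclass (X x) @[x --> F] --> (pclass u : Defs.proj R m n).
Proof.
move=> Xu u0.
apply: (@cvg_comp _ _ _ (fun x => insubd (set_pt (@const1_nonzero R m n)) (X x)) (orbit_class (@homothety_orbit R m n)) _ _ _ _ (@pi_continuous _ _ _)).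
apply/cvg_initial; have uin : u \in [set u : E | u != 0] by apply/mem_set.
rewrite insubdK//.
(* [pclass] takes a default value at 0, so [X] has to be nonzero eventually. *)
have X0 : \forall x \near F, X x != 0.
  have [[i j] /= uij] : exists ij : 'I_m.+1 * 'I_n.+1, u ij.1 ij.2 != 0.
    apply: contrapT => nex; move/eqP: u0; apply; apply/matrixP => i j.
    by rewrite mxE; apply: contrapT => /eqP uij; apply: nex; exists (i, j).
  have /cvg_mxP/(_ i j) Xij := Xu.
  have : \forall x \near F, X x i j != 0.
    apply: (Xij [set r : R | r != 0]); apply: open_nbhs_nbhs.
    by split; [exact: open_neq|].
  by apply: filterS => x; apply: contra_neq => ->; rewrite mxE.
apply: cvg_trans Xu; apply: near_eq_cvg; apply: filterS X0 => x Xx0.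
by rewrite /= insubdK//; exact/mem_set.
Qed.

Lemma nonzero_normC (u : nonzero R m n) : `|val u| != 0.
Proof. by rewrite normr_eq0; exact: (set_mem (valP u)). Qed.

(** A two-by-two minor of the pair [(u, v)], divided by the norm of [u] so as to depend only on the
    class of [u]. Vanishing for all [a] and [b] means proportionality, so these functions separate
    points. *)
Definition minor_dist v (a b : 'I_m.+1 * 'I_n.+1) (u : nonzero R m n) : R :=
  `|val u a.1 a.2 * v b.1 b.2 - val u b.1 b.2 * v a.1 a.2| / `|val u|.

Lemma continuous_minor_dist v a b : continuous (minor_dist v a b).
Proof.
move=> u; have FF : Filter (nbhs u) := nbhs_filter u.
have cu : val x @[x --> u] --> val u by exact: continuous_val.
have cu' := (cvg_mxP _ _).1 cu.
apply: (@cvgM _ _ _ FF); last first.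
  by apply: (@cvgV _ _ _ FF); [exact: nonzero_normC|exact: (@cvg_norm _ _ _ _ FF)].
apply: (@cvg_norm _ _ _ _ FF); apply: (@cvgB _ _ _ _ FF); apply: (@cvgM _ _ _ FF);
  first [exact: cu'|exact: (@cvg_cst _ _ _ _ FF)].
Qed.

Lemma continuous_proj_minor_dist v a b :
  continuous (minor_dist v a b \o repr : Defs.proj R m n -> R).
Proof.
apply: repr_comp_continuous; first exact: continuous_minor_dist.
move=> u w /eqP uw.
have [c c0 wE] : homothety_orbit u w.
  have /orbit_classP-> : orbit_class (@homothety_orbit R m n) u = orbit_class (@homothety_orbit R m n) w by [].
  by exists 1; rewrite ?oner_neq0 ?scale1r.
rewrite /minor_dist wE !mxE normrZ -!mulrA -mulrBr normrM invfM mulrACA.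
by rewrite divff ?normr_eq0// mul1r.
Qed.

(** The minors against a representative of [x] tend both to those of [y] and to those of [x], which
    are 0; hence [y] is proportional to [x]. *)
Lemma proj_cvg_unique (T : Type) (F : set_system T) {FF : ProperFilter F}
    (X : T -> Defs.proj R m n) (x y : Defs.proj R m n) :
  X @ F --> x -> X @ F --> y -> x = y.
Proof.
move=> Xx Xy.
have D a b : minor_dist (prepr x) a b (repr y) = 0.
  have cx := cvg_comp _ _ Xx (@continuous_proj_minor_dist (prepr x) a b x).
  have cy := cvg_comp _ _ Xy (@continuous_proj_minor_dist (prepr x) a b y).
  rewrite -[LHS](cvg_unique _ cx cy) //=.
  by rewrite /minor_dist /prepr [X in _ - X]mulrC subrr normr0 mul0r.
have [[i j] /= xij] : exists ij : 'I_m.+1 * 'I_n.+1, prepr x ij.1 ij.2 != 0.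
  apply: contrapT => nex; have /eqP := prepr_neq0 x; apply; apply/matrixP => i j.
  by rewrite mxE; apply: contrapT => /eqP uij; apply: nex; exists (i, j).
have yE : prepr y = (prepr y i j / prepr x i j) *: prepr x.
  apply/matrixP => k l; rewrite mxE; have := D (k, l) (i, j).
  move/eqP; rewrite /minor_dist mulf_eq0 invr_eq0 (negPf (nonzero_normC _)) orbF normr_eq0 subr_eq0 /=.
  by move=> /eqP e; apply: (mulIf xij); rewrite [LHS]e mulrAC divfK.
rewrite -[x]preprK -[y]preprK; apply/pclassP; rewrite ?prepr_neq0//.
exists (prepr y i j / prepr x i j) => //.
by apply: contra_neq (prepr_neq0 y) => c0; rewrite yE c0 scale0r.
Qed.

End Proj.

Lemma ord3_ind (P : 'I_3 -> Prop) : P 0 -> P 1 -> P 2%:R -> forall i, P i.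
Proof.
move=> P0 P1 P2 [[|[|[|//]]] i3]; [rewrite (_ : Ordinal i3 = 0)|
  rewrite (_ : Ordinal i3 = 1)|rewrite (_ : Ordinal i3 = 2%:R)] => //; exact: val_inj.
Qed.

Section Frames.
Variable R : realType.
Implicit Types (l : PVd R) (p : GL3 R).

Definition frame_point (y : Y R) (j : 'I_3) : PV R :=
  if j == 0 then (val y).1.1 else if j == 1 then (val y).1.2 else (val y).2.

Lemma frame_point_frame p j : frame_point (frame p) j = pclass (col j (val p)).
Proof.
by move: j; apply: ord3_ind.
Qed.

Lemma frame_point_inj (y y' : Y R) :
  (forall j, frame_point y j = frame_point y' j) -> y = y'.
Proof.
move=> yy'; apply: val_inj; have := (yy' 0, yy' 1, yy' 2%:R).
by rewrite /frame_point /=; case: (val y) (val y') => -[a b] c [[a' b'] c'] /= [[-> ->] ->].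
Qed.

(** A linear form killing all the columns would be a line through the three points of the frame. *)
Lemma unitmx_frame (P : 'M[R]_3) (y : Y R) : (forall j, col j P != 0) ->
  (forall j, pclass (col j P) = frame_point y j) -> P \in unitmx.
Proof.
move=> P0 Py; rewrite unitmxE unitfE; apply/negP => /det0P[l l0 lP].
apply: (set_mem (valP y)); exists (pclass l).
have H j : incident (frame_point y j) (pclass l).
  by rewrite -Py; apply/incidentP => //; rewrite -[col j P]/(col j P) colE mulmxA lP mul0mx.
by split; [exact: (H 0)|exact: (H 1)|exact: (H 2%:R)].
Qed.

Lemma frame_lift (y : Y R) :
  exists p, frame p = y /\ forall j, `|col j (val p)| = 1.
Proof.
pose u j := prepr (frame_point y j).
pose P : 'M[R]_3 := \matrix_(i, j) (`|u j|^-1 * u j i 0).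
have colP j : col j P = `|u j|^-1 *: u j by apply/colP => i; rewrite !mxE.
have u0 j : u j != 0 := prepr_neq0 _.
have nu0 j : `|u j| != 0 by rewrite normr_eq0.
have PU : P \in unitmx.
  apply: (@unitmx_frame _ y) => j; rewrite colP.
    by rewrite scaler_eq0 invr_eq0 negb_or nu0 u0.
  by rewrite pclassZ ?invr_eq0// preprK.
exists (set_pt (PU : [set p : 'M[R]_3 | p \in unitmx] P)); split.
  apply: frame_point_inj => j; rewrite frame_point_frame /= colP.
  by rewrite pclassZ ?invr_eq0// preprK.
by move=> j; rewrite /= colP normrZ normfV normr_id mulVf.
Qed.

Lemma le_mx_norm m n (M : 'M[R]_(m, n)) i j : `|M i j| <= `|M|.
Proof.
by rewrite [leRHS]/Num.norm /= mx_normrE; exact: (le_bigmax _ _ (i, j)).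
Qed.

Lemma continuous_frame_point j : continuous (frame_point^~ j).
Proof.
have c := @continuous_val _ (@noncollinear R).
rewrite /frame_point => y; case: eqP => _; last case: eqP => _.
- exact: (cvg_comp _ _ (c y) (cvg_comp _ _ cvg_fst cvg_fst)).
- exact: (cvg_comp _ _ (c y) (cvg_comp _ _ cvg_fst cvg_snd)).
- exact: (cvg_comp _ _ (c y) cvg_snd).
Qed.

(** The unit columns given by [frame_lift] are bounded, so they converge along the ultrafilter;
    their limits have norm 1, represent the points of [y], and are therefore independent. *)
Lemma frame_lift_cvg (T : Type) (F : set_system T) (y_ : T -> Y R) y :
  UltraFilter F -> y_ @ F --> y ->
  exists (p_ : T -> GL3 R) (p : GL3 R),
    [/\ forall x, frame (p_ x) = y_ x, forall x j, `|col j (val (p_ x))| = 1,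
        frame p = y & (fun x => val (p_ x)) @ F --> val p].
Proof.
move=> FU y_y.
pose p_ x := sval (cid (frame_lift (y_ x))).
have p_P x : frame (p_ x) = y_ x /\ forall j, `|col j (val (p_ x))| = 1.
  by rewrite /p_; case: cid.
have [P p_cvg] : exists P : 'M[R]_3, (fun x => val (p_ x)) @ F --> P.
  apply: (@ultrafilter_mx_cvg _ _ _ _ _ _ 1); apply: nearW => x i j.
  rewrite -((p_P x).2 j); have -> : val (p_ x) i j = col j (val (p_ x)) i 0 by rewrite mxE.
  exact: le_mx_norm.
have P0 j : col j P != 0.
  have c : `|col j (val (p_ x))| @[x --> F] --> `|col j P| by apply: cvg_norm; exact: cvg_col.
  have c1 : `|col j (val (p_ x))| @[x --> F] --> (1 : R).
    by under eq_fun do rewrite (p_P _).2; exact: cvg_cst.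
  by rewrite -normr_eq0 (cvg_unique _ c c1) //= oner_eq0.
have Py j : pclass (col j P) = frame_point y j.
  apply: (@proj_cvg_unique _ _ _ _ F _ (fun x => pclass (col j (val (p_ x))))).
    by apply: cvg_pclass => //; exact: cvg_col.
  under eq_fun do rewrite -frame_point_frame (p_P _).1.
  exact: (cvg_comp _ _ y_y (@continuous_frame_point j y)).
have PU := unitmx_frame P0 Py.
exists p_, (set_pt (PU : [set p : 'M[R]_3 | p \in unitmx] P)); split => //.
- by move=> x; have [] := p_P x.
- by move=> x; have [] := p_P x.
- by apply: frame_point_inj => j; rewrite frame_point_frame.
Qed.

Lemma row_mul_col m n q (A : 'M[R]_(m, n)) (B : 'M[R]_(n, q)) i j :
  row i A *m col j B = ((A *m B) i j)%:M.
Proof.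
apply/matrixP => a b; rewrite !ord1 !mxE mulr1n.
by apply: eq_bigr => k _; rewrite !mxE.
Qed.

Lemma row_invmx_col p i j :
  row i (invmx (val p)) *m col j (val p) = (i == j)%:R%:M.
Proof. by rewrite row_mul_col mulVmx ?GL3_unitmx// mxE. Qed.

Lemma row_invmx_neq0 p j : row j (invmx (val p)) != 0.
Proof.
apply/negP => /eqP r0; have := row_invmx_col p j j.
by rewrite r0 mul0mx => /matrixP/(_ 0 0); rewrite !mxE !eqxx => /esym/eqP; rewrite oner_eq0.
Qed.

(** The rows of the inverse of [p] are the basis dual to its columns, so the coordinates of a form
    are its values on these columns. *)
Lemma row_frameE p (l : 'rV[R]_3) :
  l = \sum_j (l *m col j (val p)) 0 0 *: row j (invmx (val p)).
Proof.
rewrite -{1}(mulmxK (GL3_unitmx p) l) mulmx_sum_row; apply: eq_bigr => j _.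
by congr (_ *: _); rewrite !mxE; apply: eq_bigr => k _; rewrite !mxE.
Qed.

Lemma col_frameE p (u : 'cV[R]_3) :
  u = \sum_j (row j (invmx (val p)) *m u) 0 0 *: col j (val p).
Proof.
apply: trmx_inj; rewrite linear_sum -{1}(mulKVmx (GL3_unitmx p) u) trmx_mul mulmx_sum_row.
apply: eq_bigr => j _; rewrite linearZ /= tr_col; congr (_ *: _).
by rewrite !mxE; apply: eq_bigr => k _; rewrite !mxE.
Qed.

Lemma line_through_frame p :
  line_through (pclass (col 0 (val p))) (pclass (col 1 (val p))) =
  pclass (row 2%:R (invmx (val p))).
Proof.
have p0 j := col_neq0 p j; have r0 j := row_invmx_neq0 p j.
apply: xget_unique => [|l [h0 h1]].
  by split; apply/incidentP => //; rewrite row_invmx_col /= mulr0n raddf0.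
rewrite -(preprK l) in h0 h1 *.
move/incidentP: h0 => /(_ (p0 0) (prepr_neq0 l)) h0.
move/incidentP: h1 => /(_ (p0 1) (prepr_neq0 l)) h1.
have lE : prepr l = (prepr l *m col 2%:R (val p)) 0 0 *: row 2%:R (invmx (val p)).
  rewrite [LHS](row_frameE p) (bigD1 2%:R) //= big1 ?addr0//.
  by apply: ord3_ind => // _; rewrite ?h0 ?h1 mxE scale0r.
rewrite lE pclassZ//; apply: contra_neq (prepr_neq0 l) => c0.
by rewrite lE c0 scale0r.
Qed.

Lemma pi_plus_frame p :
  pi_plus (frame p) = (pclass (col 0 (val p)), pclass (row 2%:R (invmx (val p)))).
Proof. by rewrite /pi_plus /= line_through_frame. Qed.

Lemma continuous_actV (g : SL R 3) : continuous (actV g).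
Proof.
apply/quotient_continuous.
have u0 (v : nonzero R 2 0) : val v != 0 := set_mem (valP v).
have piE (v : nonzero R 2 0) : orbit_class (@homothety_orbit R 2 0) v = pclass (val v).
  by rewrite /pclass valKd.
suff : continuous (actV g \o orbit_class (@homothety_orbit R 2 0)) by [].
have -> : actV g \o orbit_class (@homothety_orbit R 2 0) = (fun v => pclass (val g *m val v)).
  by apply/funext => v; rewrite /= piE actV_pclass.
move=> u; have FF : Filter (nbhs u) := nbhs_filter u.
apply: cvg_pclass; last by apply: unitmx_neq0 => //; exact: SL_unitmx.
by apply: cvg_mulmx; [exact: cvg_cst|exact: continuous_val].
Qed.

Lemma continuous_actY (g : SL R 3) : continuous (actY g).
Proof.
move=> y; have FF : Filter (nbhs y) := nbhs_filter y; apply/cvg_initial => /=.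
have c j : actV g (frame_point z j) @[z --> y] --> actV g (frame_point y j).
  exact: (cvg_comp _ _ (@continuous_frame_point j y) (@continuous_actV g _)).
have c3 := cvg_pair (cvg_pair (c 0) (c 1)) (c 2%:R).
exact: c3.
Qed.

Lemma frame_actGL (g : SL R 3) p : frame (actGL g p) = actY g (frame p).
Proof.
apply: frame_point_inj => j; rewrite frame_point_frame /=.
rewrite colE -mulmxA -colE -actV_pclass ?col_neq0// -frame_point_frame.
by rewrite /frame_point; case: eqP => // _; case: eqP.
Qed.

Lemma frame_eqP p q : frame p = frame q ->
  exists d : 'rV[R]_3, (forall j, d 0 j != 0) /\ val q = val p *m diag_mx d.
Proof.
move=> pq; have H j : exists c : R, c != 0 /\ col j (val q) = c *: col j (val p).
  have := congr1 (frame_point^~ j) pq; rewrite !frame_point_frame.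
  by move/pclassP => /(_ (col_neq0 _ _) (col_neq0 _ _))[c c0 ->]; exists c.
pose d j := sval (cid (H j)); have dP j : d j != 0 /\ col j (val q) = d j *: col j (val p).
  by rewrite /d; case: cid.
exists (\row_j d j); split=> [j|]; first by rewrite mxE; case: (dP j).
apply/matrixP => i j; rewrite mul_mx_diag !mxE mulrC.
by have /matrixP/(_ i 0) := (dP j).2; rewrite !mxE.
Qed.

Lemma pi_plus_actY (g : SL R 3) y : pi_plus (actY g y) = actF g (pi_plus y).
Proof.
have [p [<- _]] := frame_lift y; rewrite -frame_actGL !pi_plus_frame /actF /=.
rewrite actV_pclass ?col_neq0// actVd_pclass ?row_invmx_neq0//.
rewrite colE -mulmxA -colE; congr (_, pclass _).
by rewrite invmx_mul ?GL3_unitmx ?SL_unitmx// row_mul.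
Qed.

End Frames.

(** * Discrete subgroups and the lift of the section *)

Section DiscreteSubgroups.
Variables (R : realType) (n : nat) (Gam : groupType).
Variable iota : {multiplicative Gam -> SL R n}.
Hypothesis iota_inj : injective iota.
Hypothesis iota_discrete : discrete_subset (range iota).

Lemma discrete_nbhs1 : exists2 V : set (SL R n), nbhs (1%g : SL R n) V &
  forall g, V (iota g) -> g = 1%g.
Proof.
have [|_ [V]] := iota_discrete (t := iota 1%g); first by exists 1%g.
rewrite multiplicative1 => V1 VE; exists V => // g Vg.
have : (V `&` range iota) (iota g) by split=> //; exists g.
by rewrite VE /= -(multiplicative1 iota) => /iota_inj.
Qed.

(** The quotient y x^-1 tends to 1 as x and y tend to [h], so it enters a neighbourhood of 1 free of
    nontrivial elements of the group. *)
Lemma discrete_wandering (h : SL R n) : exists2 W : set (SL R n), nbhs h W &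
  forall g x, W x -> W (iota g * x)%g -> g = 1%g.
Proof.
have [V V1 VE] := discrete_nbhs1.
have FF : Filter (nbhs (h, h)) := nbhs_filter _.
have : (p.2 * p.1^-1)%g @[p --> (h, h)] --> (1 : SL R n)%g.
  rewrite -(mulgV h); apply: cvg_SL_mul; first exact: cvg_snd.
  by apply: cvg_SL_inv; exact: cvg_fst.
move=> /(_ _ V1)[[A B] /= [hA hB] AB].
exists (A `&` B); first exact: filterI.
move=> g x [Ax _] [_ Bx]; apply: VE; have := AB (x, _) (conj Ax Bx).
by rewrite /= -mulgA mulgV mulg1.
Qed.

(** Otherwise, along an ultrafilter escaping finite sets, these bounded matrices converge to some
    [h] of determinant 1. Two distinct elements of the group close to [h] then have a quotient close
    to 1, against discreteness. *)
Lemma discrete_bounded_finite C : finite_set [set g | `|val (iota g)| <= C].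
Proof.
apply: contrapT => /infinite_ultrafilter[U [UU UC Ufin]].
have [A iA] : exists A : 'M[R]_n, (fun g => val (iota g)) @ U --> A.
  apply: (@ultrafilter_mx_cvg _ _ _ _ _ _ C); apply: filterS UC => g gC i j.
  exact: le_trans (le_mx_norm _ _ _) gC.
have A1 : \det A = 1.
  have c1 : \det (val (iota g)) @[g --> U] --> (1 : R).
    by under eq_fun do rewrite SL_det; exact: cvg_cst.
  exact: (cvg_unique _ (cvg_det iA) c1).
pose h : SL R n := set_pt (A1 : [set g : 'M[R]_n | \det g = 1] A).
have ih : iota @ U --> h by apply/cvg_initial.
have [V V1 VE] := discrete_nbhs1.
have FF : Filter (nbhs (h, h)) := nbhs_filter _.
have : (p.1^-1 * p.2)%g @[p --> (h, h)] --> (1 : SL R n)%g.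
  rewrite -(mulVg h); apply: cvg_SL_mul; last exact: cvg_snd.
  by apply: cvg_SL_inv; exact: cvg_fst.
move=> /(_ _ V1)[[B B'] /= [hB hB'] BB'].
have UB : U (iota @^-1` B) := ih _ hB.
have UB' : U (iota @^-1` B') := ih _ hB'.
have [g Bg] := filter_ex UB.
have [k [B'k kg]] := filter_ex (filterI UB' (Ufin _ (finite_set1 g))).
apply: kg => /=; apply: (mulgI g^-1%g); rewrite mulVg; apply: VE.
rewrite gmulfM multiplicativeV; exact: (BB' (_, _) (conj Bg B'k)).
Qed.

End DiscreteSubgroups.

Section Lift.
Variables (R : realType) (Gam : groupType).
Variables (iota : {multiplicative Gam -> SL R 2}) (rho : {multiplicative Gam -> SL R 3}).
Hypothesis iota_inj : injective iota.
Hypothesis iota_discrete : discrete_subset (range iota).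
Variables (s : M iota -> Erho iota rho) (f : SL R 2 -> Y R).
Hypothesis s_sec : forall m, pi_rho (s m) = m.
Hypothesis f_lifts_s : lifts f s.

Lemma classE_inj h y y' : classE iota rho h y = classE iota rho h y' -> y = y'.
Proof.
move=> /classE_eq[g /= [/esym hE ->]]; suff -> : g = 1%g by rewrite multiplicative1 actY1.
apply: iota_inj; rewrite multiplicative1; apply: (mulIg h).
by rewrite mul1g.
Qed.

Lemma lift_equivariant g h : f (iota g * h)%g = actY (rho g) (f h).
Proof.
apply: (@classE_inj (iota g * h)%g); rewrite -f_lifts_s.
have -> : classM iota (iota g * h)%g = classM iota h.
  by apply/esym/classM_eq; exists g.
by rewrite f_lifts_s; apply/classE_eq; exists g.
Qed.

Lemma lift_flow t h : (forall m, range s (flowE t (s m))) ->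
  f (h * geod t)%g = f h.
Proof.
move=> /(_ (classM iota h))[m _]; rewrite f_lifts_s flowE_classE => sm.
have mE : m = classM iota (h * geod t)%g.
  by rewrite -(s_sec m) sm pi_rho_classE.
by apply: (@classE_inj (h * geod t)%g); rewrite -f_lifts_s -mE.
Qed.

Lemma classE_nbhs h y (U : set (SL R 2 * Y R)) : nbhs (h, y) U ->
  nbhs (classE iota rho h y) (orbit_class (@E_orbit _ _ iota rho) @` U).
Proof.
apply: orbit_class_nbhs => {h y U} -[h y] [h' y'] /classE_eq[g /= [-> ->]].
exists (fun q => ((iota g)^-1 * q.1, actY (rho g)^-1 q.2))%g; split=> /=.
- move=> [k z]; have FF : Filter (nbhs (k, z)) := nbhs_filter _.
  have c1 : ((iota g)^-1 * q.1)%g @[q --> (k, z)] --> ((iota g)^-1 * k)%g.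
    by apply: cvg_SL_mul; [exact: cvg_cst|exact: cvg_fst].
  have c2 : actY (rho g)^-1%g q.2 @[q --> (k, z)] --> actY (rho g)^-1%g z.
    apply: (@cvg_comp _ _ _ snd (actY (rho g)^-1%g) _ (nbhs z)); first exact: cvg_snd.
    exact: continuous_actY.
  exact: (cvg_pair c1 c2).
- by rewrite mulKg -actYM mulVg actY1.
- case=> k z; apply/esym/classE_eq; exists g^-1%g; by rewrite /= !multiplicativeV.
Qed.

(** For [k] near [h], the point [s (classM k)] has a representative in [W] times [V]. It agrees with
    [(k, f k)] up to some [g], and [g] is 1 because [W] is wandering. *)
Lemma lift_continuous : continuous s -> continuous f.
Proof.
move=> s_cont h V fV.
have [W hW WE] := discrete_wandering iota_inj iota_discrete h.
have UE : nbhs (h, f h) (W `*` V) by exists (W, V).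
have := classE_nbhs UE; rewrite -f_lifts_s => /(s_cont _).
have cM : {for h, continuous (classM iota)} by exact: (@pi_continuous _ _ h).
move=> /cM nU; apply: filterS (filterI hW nU) => k [Wk /= [[k' y] /= [Wk' Vy]]].
rewrite f_lifts_s -[orbit_class _ _]/(classE iota rho k' y).
move=> /classE_eq[g /= [kE fk]].
have g1 : g = 1%g by apply: (WE g k') => //; rewrite -kE.
by rewrite /= fk g1 multiplicative1 actY1.
Qed.

End Lift.

(** * An invariant continuous norm *)

Section InvariantNorm.
Variables (R : realType) (Gam : groupType).
Variables (iota : {multiplicative Gam -> SL R 2}) (rho : {multiplicative Gam -> SL R 3}).
Hypothesis iota_inj : injective iota.
Hypothesis iota_discrete : discrete_subset (range iota).
Implicit Types (g k : Gam) (h : SL R 2) (u : 'cV[R]_3).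

Definition displ g h : R := `|val ((iota g)^-1 * h)%g|.
Definition min_displ h : R := inf (range (displ^~ h)).
(** Positive exactly when [displ g h] exceeds its infimum over the group by less than 1: a bump
    function, equivariant by construction and locally finite by discreteness. *)
Definition weight g h : R := Num.max 0 (1 + min_displ h - displ g h).
(** An average over the group of the norms transported by [rho]: an invariant family of norms over
    [SL R 2], that is, a norm on the flat bundle over [M] with fiber the space of column vectors. *)
Definition vnorm h u : R :=
  \sum_(g \in [set: Gam]) weight g h * `|val ((rho g)^-1)%g *m u|.

Lemma displM k g h : displ (k * g)%g (iota k * h)%g = displ g h.
Proof. by rewrite /displ gmulfM invgM -mulgA mulKg. Qed.

Lemma min_displM k h : min_displ (iota k * h)%g = min_displ h.
Proof.
congr inf; apply/seteqP; split=> _ [g _ <-].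
  by exists (k^-1 * g)%g => //; rewrite -(displM k) mulVKg.
by exists (k * g)%g => //; rewrite displM.
Qed.

Lemma weightM k g h : weight (k * g)%g (iota k * h)%g = weight g h.
Proof. by rewrite /weight displM min_displM. Qed.

Lemma displ_has_inf h : has_inf (range (displ^~ h)).
Proof.
split; first by exists (displ 1%g h); exists 1%g.
by exists 0 => _ [g _ <-]; exact: normr_ge0.
Qed.

Lemma min_displ_le g h : min_displ h <= displ g h.
Proof. by apply: ge_inf; [exact: (displ_has_inf h).2|exists g]. Qed.

Lemma weight_ge0 g h : 0 <= weight g h.
Proof. by rewrite le_max lexx. Qed.

Lemma weight_gt0 h : exists g, 0 < weight g h.
Proof.
have [_ [g _ <-] gh] := inf_adherent ltr01 (displ_has_inf h).
by exists g; rewrite lt_max subr_gt0 [1 + _]addrC gh orbT.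
Qed.

(** Bounds the growth of [displ g] from [h] to [h'], uniformly in [g]; the 2 is the factor of
    [mxnorm_mulmx] for matrices of size 2. *)
Definition distort (h h' : SL R 2) : R := 1 + 2 * `|val (h^-1 * h')%g - 1%:M|.

Lemma distort_gt0 h h' : 0 < distort h h'.
Proof. by rewrite /distort ltr_pwDl// mulr_ge0. Qed.

Lemma displ_distort g h h' : displ g h' <= distort h h' * displ g h.
Proof.
rewrite /displ /distort.
have -> : val ((iota g)^-1 * h')%g = val ((iota g)^-1 * h)%g +
    val ((iota g)^-1 * h)%g *m (val (h^-1 * h')%g - 1%:M).
  rewrite mulmxBr mulmx1 addrC subrK.
  rewrite -[RHS]/(val (((iota g)^-1 * h) * (h^-1 * h'))%g).
  by rewrite !mulgA mulgK.
apply: le_trans (ler_normD _ _) _; rewrite mulrDl mul1r lerD2l.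
by apply: le_trans (mxnorm_mulmx _ _) _; rewrite -!mulrA [`|_| * _]mulrC.
Qed.

Lemma min_displ_distort h h' : min_displ h' <= distort h h' * min_displ h.
Proof.
rewrite -ler_pdivrMl ?distort_gt0//; apply: lb_le_inf; first exact: (displ_has_inf h).1.
move=> _ [g _ <-]; rewrite ler_pdivrMl ?distort_gt0//.
exact: le_trans (min_displ_le g h') (displ_distort g h h').
Qed.

Lemma cvg_distort (T : Type) (F : set_system T) {FF : Filter F} (X Y : T -> SL R 2) h :
  X @ F --> h -> Y @ F --> h -> distort (X x) (Y x) @[x --> F] --> (1 : R).
Proof.
move=> Xh Yh.
have c : ((X x)^-1 * Y x)%g @[x --> F] --> (1 : SL R 2)%g.
  by rewrite -(mulVg h); apply: cvg_SL_mul => //; exact: cvg_SL_inv.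
have {}c : val (X x)^-1%g *m val (Y x) - 1%:M @[x --> F] --> (0 : 'M[R]_2).
  rewrite -(subrr (1%:M : 'M[R]_2)); apply: cvgB; last exact: cvg_cst.
  by move/cvg_initial: c.
rewrite -[X in _ --> X]addr0; apply: cvgD; first exact: cvg_cst.
rewrite -(mulr0 2); apply: cvgM; first exact: cvg_cst.
by rewrite -(normr0 'M[R]_2); exact: cvg_norm.
Qed.

Lemma continuous_displ g : continuous (displ g).
Proof.
move=> h; have FF : Filter (nbhs h) := nbhs_filter h; apply: cvg_norm.
by apply: cvg_mulmx; [exact: cvg_cst|exact: continuous_val].
Qed.

(** An infimum of continuous functions need not be continuous; here the distortion bound, uniform in
    [g], squeezes it from both sides. *)
Lemma continuous_min_displ : continuous min_displ.
Proof.
move=> h; have FF : Filter (nbhs h) := nbhs_filter h.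
have c1 : distort h h' * min_displ h @[h' --> h] --> min_displ h.
  rewrite -[X in _ --> X]mul1r; apply: cvgM; last exact: cvg_cst.
  by apply: cvg_distort; [exact: cvg_cst|exact: cvg_id].
have c2 : min_displ h / distort h' h @[h' --> h] --> min_displ h.
  rewrite -[X in _ --> X]divr1; apply: cvgM; first exact: cvg_cst.
  apply: cvgV; first exact: oner_neq0.
  by apply: cvg_distort; [exact: cvg_id|exact: cvg_cst].
apply: (squeeze_cvgr _ c2 c1); apply: nearW => h'.
by rewrite min_displ_distort ler_pdivrMr ?distort_gt0// mulrC min_displ_distort.
Qed.

Lemma continuous_weight g : continuous (weight g).
Proof.
move=> h; have FF : Filter (nbhs h) := nbhs_filter h.
have c : 1 + min_displ h' - displ g h' @[h' --> h] --> 1 + min_displ h - displ g h.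
  apply: cvgB; last exact: continuous_displ.
  by apply: cvgD; [exact: cvg_cst|exact: continuous_min_displ].
have E (x : R) : Num.max 0 x = (x + `|x|) / 2.
  by case: (leP 0 x) => x0; [rewrite ger0_norm|rewrite ltr0_norm]; rewrite // ?subrr ?mul0r//; lra.
have wE : weight g = fun h' => (1 + min_displ h' - displ g h' + `|1 + min_displ h' - displ g h'|) / 2.
  by apply/funext => h'; rewrite /weight E.
by rewrite wE; apply: cvgM; [apply: cvgD => //; exact: cvg_norm|exact: cvg_cst].
Qed.

Lemma weight_locally_finite h : exists B : set Gam, finite_set B /\
  \forall h' \near h, forall g, weight g h' != 0 -> B g.
Proof.
have FF : Filter (nbhs h) := nbhs_filter h.
(* For [h'] near [h] and a nonzero weight, [displ g h'] is less than 1 plus the norm of [h'], hence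
   than 2 plus that of [h]. The last factor bounds the inverse of [h'], and the first 2 comes from
   [mxnorm_mulmx]. *)
pose C := 2 * (2 + `|val h|) * (1 + `|val (h^-1)%g|).
exists [set g | `|val (iota g^-1)%g| <= C]; split.
  rewrite [X in finite_set X](_ : _ = (fun g => g^-1%g) @` [set g | `|val (iota g)| <= C]).
    exact/finite_image/discrete_bounded_finite.
  apply/seteqP; split=> [g gC|_ [g gC <-]] /=; last by rewrite invgK.
  by exists g^-1%g; rewrite //= invgK.
have n1 : nbhs h [set h' : SL R 2 | `|val h'| < 1 + `|val h|].
  have c : `|val h'| @[h' --> h] --> `|val h| by apply: cvg_norm; exact: continuous_val.
  by apply: (c [set x | x < 1 + `|val h|]); apply: lt_nbhsl; rewrite ltrDr.
have n2 : nbhs h [set h' : SL R 2 | `|val (h'^-1)%g| < 1 + `|val (h^-1)%g|].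
  have c : (fun h' : SL R 2 => `|val (h'^-1)%g|) @ h --> `|val h^-1%g|.
    apply: cvg_norm; have : (fun h' : SL R 2 => (h'^-1)%g) @ h --> (h^-1)%g.
      by apply: cvg_SL_inv; exact: cvg_id.
    by move/cvg_initial.
  by apply: (c [set x | x < 1 + `|val h^-1%g|]); apply: lt_nbhsl; rewrite ltrDr.
apply: filterS (filterI n1 n2) => h' [/= h1 h2] g.
rewrite /weight; case: (leP (1 + min_displ h' - displ g h') 0) => [_|+ _].
  by rewrite eqxx.
rewrite subr_gt0 => gh; rewrite /=.
have m1 : min_displ h' <= `|val h'|.
  apply: le_trans (min_displ_le 1%g h') _.
  by rewrite /displ multiplicative1 invg1 mul1g.
rewrite multiplicativeV; have -> : val ((iota g)^-1)%g = val ((iota g)^-1 * h')%g *m val (h'^-1)%g.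
  by rewrite -[RHS]/(val ((iota g)^-1 * h' * h'^-1)%g) mulgK.
apply: le_trans (mxnorm_mulmx _ _) _; rewrite /C -!mulrA ler_pM2l//.
apply: ler_pM => //; last exact: ltW.
by rewrite (le_trans (ltW gh))//; lra.
Qed.

Lemma vnormE h : exists r : seq Gam,
  (forall g, weight g h != 0 -> g \in r) /\
  \forall h' \near h, forall u,
    vnorm h' u = \sum_(g <- r) weight g h' * `|val ((rho g)^-1)%g *m u|.
Proof.
have [B [Bfin BP]] := weight_locally_finite h.
exists (finmap.enum_fset (fset_set B)); split=> [g gh|].
  by rewrite (in_fset_set Bfin); apply/mem_set; exact: (nbhs_singleton BP).
apply: filterS BP => h' BP u; rewrite -fsbig_finite//.
apply/esym/fsbig_widen => // g [_ Bg] /=.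
by apply: contrapT => /eqP; rewrite mulf_eq0 negb_or => /andP[/BP].
Qed.

Lemma vnormE1 h : exists r : seq Gam,
  (forall g, weight g h != 0 -> g \in r) /\
  forall u, vnorm h u = \sum_(g <- r) weight g h * `|val ((rho g)^-1)%g *m u|.
Proof.
by have [r [rh /nbhs_singleton rE]] := vnormE h; exists r.
Qed.

(** Left translation by [k] permutes the terms of the sum. *)
Lemma vnormM k h u : vnorm (iota k * h)%g (val (rho k) *m u) = vnorm h u.
Proof.
rewrite /vnorm (reindex_fsbigT (fun g => (k * g)%g)); last first.
  by exists (fun g => (k^-1 * g)%g) => g; rewrite ?mulKg ?mulVKg.
apply: eq_fsbigr => g _; rewrite weightM gmulfM invgM; congr (_ * `|_|).
by rewrite /= -mulmxA mulKmx ?SL_unitmx.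
Qed.

Lemma vnormZ h (c : R) u : vnorm h (c *: u) = `|c| * vnorm h u.
Proof.
have [r [_ rE]] := vnormE1 h; rewrite !rE mulr_sumr; apply: eq_bigr => g _.
by rewrite -scalemxAr normrZ mulrCA.
Qed.

Lemma vnorm_gt0 h u : u != 0 -> 0 < vnorm h u.
Proof.
have [r [rh rE]] := vnormE1 h; move=> u0.
have ge0 g : true -> 0 <= weight g h * `|val ((rho g)^-1)%g *m u|.
  by move=> _; rewrite mulr_ge0 ?weight_ge0.
rewrite rE lt_neqAle sumr_ge0// andbT eq_sym psumr_eq0//.
have [g /lt0r_neq0 gh] := weight_gt0 h; apply/negP => /allP/(_ g (rh _ gh)) /=.
apply/negP; rewrite mulf_neq0// normr_eq0; apply: unitmx_neq0 u0.
by rewrite unitmx_inv SL_unitmx.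
Qed.

Lemma cvg_vnorm (T : Type) (F : set_system T) {FF : Filter F} (X : T -> SL R 2)
    (U : T -> 'cV[R]_3) h u :
  X @ F --> h -> U @ F --> u -> vnorm (X x) (U x) @[x --> F] --> vnorm h u.
Proof.
move=> Xh Uu; have [r [_ rE]] := vnormE h.
rewrite (nbhs_singleton rE).
have c : \sum_(g <- r) weight g (X x) * `|val ((rho g)^-1)%g *m U x| @[x --> F] -->
    \sum_(g <- r) weight g h * `|val ((rho g)^-1)%g *m u|.
  apply: cvg_big => [|g _]; first exact: add_continuous.
  apply: cvgM; first exact: (cvg_comp _ _ Xh (@continuous_weight g h)).
  by apply: cvg_norm; apply: cvg_mulmx => //; exact: cvg_cst.
apply: cvg_trans c; apply: near_eq_cvg.
have {}rE : \forall x \near F, forall u, vnorm (X x) u =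
  \sum_(g <- r) weight g (X x) * `|val ((rho g)^-1)%g *m u| := Xh _ rE.
by apply: filterS rE => x xE /=; rewrite xE.
Qed.

End InvariantNorm.

(** * The induced norm on the vertical tangent bundle *)

Section TangentNorm.
Variables (R : realType) (Gam : groupType).
Variables (iota : {multiplicative Gam -> SL R 2}) (rho : {multiplicative Gam -> SL R 3}).
Hypothesis iota_inj : injective iota.
Hypothesis iota_discrete : discrete_subset (range iota).
Implicit Types (h : SL R 2) (p : GL3 R) (xi : 'M[R]_3).
Local Notation vnorm := (vnorm iota rho).
Local Notation vnormM := (vnormM iota rho).
Local Notation vnormZ := (vnormZ rho iota_inj iota_discrete).
Local Notation vnorm_gt0 := (vnorm_gt0 rho iota_inj iota_discrete).
Local Notation cvg_vnorm := (cvg_vnorm iota_inj iota_discrete).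

(* In the moving frame [p] the tangent space of [Y] is the space of matrices
   [p^-1 xi] modulo diagonal ones; its entry [(i, j)] lives in
   Hom(<p_j>, <p_i>), and is measured accordingly. *)
Definition frame_norm h p xi : R :=
  \sum_(i < 3) \sum_(j < 3 | j != i)
    `|(invmx (val p) *m xi) i j| * (vnorm h (col i (val p)) / vnorm h (col j (val p))).

Lemma vnorm_col_neq0 h p j : vnorm h (col j (val p)) != 0.
Proof. by rewrite lt0r_neq0// vnorm_gt0// col_neq0. Qed.

(** Rescaling the columns by [d] multiplies the entry (i, j) by d_j / d_i, which the ratio of norms
    compensates; [d'] only affects diagonal entries, absent from the sum. *)
Lemma frame_norm_tangent h p xi p' xi' :
  tangent_orbit (p, xi) (p', xi') -> frame_norm h p' xi' = frame_norm h p xi.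
Proof.
case=> d [d' /= [pE xiE]].
have dU : diag_mx d \in unitmx.
  by move: (GL3_unitmx p') => /=; rewrite pE unitmx_mul => /andP[].
have d0 j : d 0 j != 0.
  by move: dU; rewrite unitmxE det_diag unitfE => /prodf_neq0; exact.
have colE j : col j (val p') = d 0 j *: col j (val p).
  by rewrite /= pE mul_mx_diag; apply/colP => i; rewrite !mxE mulrC.
have inv_d : invmx (diag_mx d) = diag_mx (\row_j (d 0 j)^-1).
  apply: (can_inj (mulKmx dU)); rewrite mulmxV// mulmx_diag -diag_const_mx.
  by congr diag_mx; apply/rowP => j; rewrite !mxE divff.
apply: eq_bigr => i _; apply: eq_bigr => j ji; rewrite !colE !vnormZ.
have -> : (invmx (val p') *m xi') i j = (d 0 i)^-1 * ((invmx (val p) *m xi) i j * d 0 j).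
  rewrite /= pE xiE invmx_mul ?GL3_unitmx// inv_d mulmxDr -!mulmxA.
  rewrite [X in _ + _ *m X]mulmxA mulVmx ?GL3_unitmx// mul1mx mulmx_diag.
  rewrite [LHS]mxE [X in _ + X]mxE eq_sym (negPf ji) mulr0n addr0.
  by rewrite mul_diag_mx mxE mulmxA mul_mx_diag [X in X * _]mxE [X in _ * X]mxE.
rewrite !normrM normfV; have di : `|d 0 i| != 0 by rewrite normr_eq0.
have dj : `|d 0 j| != 0 by rewrite normr_eq0.
by have vj := vnorm_col_neq0 h p j; field; rewrite dj di vj.
Qed.

Lemma frame_norm_act k h p xi :
  frame_norm (iota k * h)%g (actGL (rho k) p) (val (rho k) *m xi) = frame_norm h p xi.
Proof.
apply: eq_bigr => i _; apply: eq_bigr => j _.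
have colE l : col l (val (actGL (rho k) p)) = val (rho k) *m col l (val p).
  by rewrite /= !colE mulmxA.
rewrite !colE !vnormM; congr (`|_| * _).
by rewrite /= invmx_mul ?GL3_unitmx ?SL_unitmx// -mulmxA mulKmx ?SL_unitmx.
Qed.

Lemma cvg_frame_norm (T : Type) (F : set_system T) {FF : Filter F} (H : T -> SL R 2)
    (P : T -> GL3 R) (X : T -> 'M[R]_3) h p xi :
  H @ F --> h -> P @ F --> p -> X @ F --> xi ->
  frame_norm (H x) (P x) (X x) @[x --> F] --> frame_norm h p xi.
Proof.
move=> Hh /cvg_initial Pp Xxi.
have V j : vnorm (H x) (col j (val (P x))) @[x --> F] --> vnorm h (col j (val p)).
  exact: (cvg_vnorm Hh (cvg_col Pp)).
apply: cvg_big => [|i _]; first exact: add_continuous.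
apply: cvg_big => [|j _]; first exact: add_continuous.
apply: cvgM; last first.
  by apply: cvgM; [exact: V|apply: cvgV; [exact: vnorm_col_neq0|exact: V]].
apply: cvg_norm; move: i j; apply/cvg_mxP; apply: cvg_mulmx => //.
by apply: cvg_invmx => //; [move=> x; exact: GL3_unitmx|exact: GL3_unitmx].
Qed.

Definition TY_norm (q : SL R 2 * TY R) : R := frame_norm q.1 (repr q.2).1 (repr q.2).2.

Lemma TY_norm_tvec h p xi : TY_norm (h, tvec p xi) = frame_norm h p xi.
Proof.
apply: frame_norm_tangent; rewrite -surjective_pairing; exact: repr_tvec.
Qed.

Lemma tvec_nbhs (q : GL3 R * 'M[R]_3) U : nbhs q U ->
  nbhs (tvec q.1 q.2) (orbit_class (@tangent_orbit R) @` U).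
Proof.
rewrite /tvec -surjective_pairing; apply: orbit_class_nbhs => {q U} -[p xi] [p' xi'].
move=> /esym/tvecP[d [d' /= [pE xiE]]].
have dU : diag_mx d \in unitmx.
  by move: (GL3_unitmx p) => /=; rewrite pE unitmx_mul => /andP[].
have psiU (q : GL3 R) : [set p : 'M[R]_3 | p \in unitmx] (val q *m diag_mx d).
  by rewrite /= unitmx_mul GL3_unitmx.
pose psi (q : GL3 R * 'M[R]_3) : GL3 R * 'M[R]_3 :=
  (set_pt (psiU q.1), q.2 *m diag_mx d + val q.1 *m diag_mx d').
exists psi; split.
- move=> [q z]; have FF : Filter (nbhs (q, z)) := nbhs_filter _.
  have vq : val r.1 @[r --> (q, z)] --> val q.
    exact: (@cvg_comp _ _ _ fst val _ (nbhs q) _ cvg_fst (@continuous_val _ _ q)).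
  have c1 : set_pt (psiU r.1) @[r --> (q, z)] --> set_pt (psiU q).
    by apply/cvg_initial; apply: cvg_mulmx => //; exact: cvg_cst.
  have c2 : r.2 *m diag_mx d + val r.1 *m diag_mx d' @[r --> (q, z)] -->
      z *m diag_mx d + val q *m diag_mx d'.
    apply: cvgD; apply: cvg_mulmx; try exact: cvg_cst; last exact: vq.
    exact: cvg_snd.
  exact: (cvg_pair c1 c2).
- by rewrite /psi /=; congr (_, _); [exact: val_inj|].
- by case=> q z; apply/esym/tvecP; exists d, d'.
Qed.

(** The product of a quotient map with an identity need not be a quotient map; openness of the
    projection to [TY], in the form of [tvec_nbhs], is what allows the descent. *)
Lemma continuous_TY_norm : continuous TY_norm.
Proof.
move=> [h t] V; rewrite -[t]tvecK; set p := (repr t).1; set xi := (repr t).2 => hV.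
have FF : Filter (nbhs (h, (p, xi))) := nbhs_filter _.
have c : frame_norm r.1 r.2.1 r.2.2 @[r --> (h, (p, xi))] --> TY_norm (h, tvec p xi).
  rewrite TY_norm_tvec; apply: cvg_frame_norm; first exact: cvg_fst.
    exact: (@cvg_comp _ _ _ snd fst _ (nbhs (p, xi)) _ cvg_snd cvg_fst).
  exact: (@cvg_comp _ _ _ snd snd _ (nbhs (p, xi)) _ cvg_snd cvg_snd).
have [[A B] /= [hA hB] AB] := c V hV.
exists (A, (orbit_class (@tangent_orbit R) @` B)).
  by split => //; exact: (@tvec_nbhs (p, xi)).
move=> [k _] [/= Ak [[q z] Bq <-]].
by rewrite /preimage /= -[orbit_class _ _]/(tvec q z) TY_norm_tvec; exact: (AB (k, (q, z))).
Qed.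

Definition VE_norm (v : VE iota rho) : R := TY_norm (repr v).

Lemma TY_norm_act k h t : TY_norm ((iota k * h)%g, actTY (rho k) t) = TY_norm (h, t).
Proof.
by rewrite /actTY TY_norm_tvec frame_norm_act.
Qed.

Lemma VE_norm_class h p xi : VE_norm (classVE iota rho h (tvec p xi)) = frame_norm h p xi.
Proof.
rewrite /VE_norm; have [g ->] := repr_classVE iota rho h (tvec p xi).
by rewrite TY_norm_act TY_norm_tvec.
Qed.

Lemma continuous_VE_norm : continuous VE_norm.
Proof.
apply: (repr_comp_continuous continuous_TY_norm) => -[h t] [h' t'] /eqP ht.
have /classVE_eq[g [-> ->]] : classVE iota rho h t = classVE iota rho h' t' by [].
by rewrite TY_norm_act.
Qed.

(** When the off-diagonal entries of p^-1 xi vanish, xi only rescales the columns of [p], hence is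
    zero as a tangent vector of [Y]. *)
Lemma frame_norm_eq0 h p xi : frame_norm h p xi = 0 -> tvec p xi = tvec p 0.
Proof.
have ge0 i j : 0 <= `|(invmx (val p) *m xi) i j| * (vnorm h (col i (val p)) / vnorm h (col j (val p))).
  by rewrite mulr_ge0// divr_ge0// ltW// vnorm_gt0// col_neq0.
move=> /eqP; rewrite psumr_eq0 => [/allP n0|i _]; last by apply: sumr_ge0.
have eta0 i j : j != i -> (invmx (val p) *m xi) i j = 0.
  move=> ji; have := n0 i (mem_index_enum _); rewrite psumr_eq0// => /allP/(_ j (mem_index_enum _)).
  rewrite ji /= !mulf_eq0 invr_eq0 !(negPf (vnorm_col_neq0 _ _ _)) !orbF normr_eq0.
  by move/eqP.
apply/esym/tvecP; exists (const_mx 1), (\row_j (invmx (val p) *m xi) j j) => /=.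
rewrite diag_const_mx mulmx1 mul0mx add0r; split=> //.
rewrite -[LHS](mulKVmx (GL3_unitmx p)); congr (_ *m _).
apply/matrixP => i j; rewrite [RHS]mxE; case: eqVneq => [->|ij].
  by rewrite mulr1n [RHS]mxE.
by rewrite mulr0n eta0// eq_sym.
Qed.

Lemma VE_norm_continuous_norm : continuous_norm VE_norm.
Proof.
split=> [|h p v]; first exact: continuous_VE_norm.
split=> [xi xi'|c xi|xi]; rewrite !VE_norm_class.
- rewrite /frame_norm -big_split; apply: ler_sum => i _ /=.
  rewrite -big_split; apply: ler_sum => j _ /=.
  rewrite -mulrDl ler_wpM2r//; last by rewrite mulmxDr mxE ler_normD.
  by rewrite divr_ge0// ltW// vnorm_gt0// col_neq0.
- rewrite /frame_norm mulr_sumr; apply: eq_bigr => i _.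
  rewrite mulr_sumr; apply: eq_bigr => j _.
  by rewrite -scalemxAr mxE normrM mulrA.
- by move=> /frame_norm_eq0 t0; rewrite /v t0.
Qed.

(** Only one entry survives. Contraction of elementary directions thus becomes a comparison between
    the growths of two frame vectors. *)
Lemma frame_norm_delta h p i j : j != i ->
  frame_norm h p (val p *m delta_mx i j) = vnorm h (col i (val p)) / vnorm h (col j (val p)).
Proof.
move=> ji; rewrite /frame_norm mulKmx ?GL3_unitmx// (bigD1 i)//= (bigD1 j)//= mxE !eqxx normr1 mul1r.
rewrite big1 => [|l /andP[_ lj]]; last by rewrite mxE (negPf lj) andbF normr0 mul0r.
rewrite addr0 big1 ?addr0// => l li; rewrite big1// => k _.
by rewrite mxE (negPf li) normr0 mul0r.
Qed.

End TangentNorm.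

(** * Elementary curves in the frame variety and Cartan decomposition *)

Section ElementaryCurves.
Variable R : realType.
Implicit Types (p : GL3 R) (i j : 'I_3).

Lemma elementary_mulV (t : R) i j : j != i ->
  (1%:M + t *: delta_mx i j) *m (1%:M - t *: delta_mx i j) = 1%:M :> 'M[R]_3.
Proof.
move=> ji; rewrite mulmxBr mulmx1 mulmxDl mul1mx -scalemxAl -scalemxAr.
by rewrite mul_delta_mx_0// !scaler0 addr0 addrK.
Qed.

Lemma elementary_unitmx (t : R) i j : j != i ->
  (1%:M + t *: delta_mx i j : 'M[R]_3) \in unitmx.
Proof. by move=> /(elementary_mulV t)/mulmx1_unit[]. Qed.

Lemma is_derive_affine (A B : 'M[R]_3) : is_derive (0 : R) 1 (fun t : R => A + t *: B) B.
Proof.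
have c : (fun h : R => h^-1 *: ((fun t : R => A + t *: B) (h *: 1 + 0) - (A + 0 *: B)))
    @ (0 : R)^' --> B.
  have cB : (fun=> B) @ (0 : R)^' --> B by exact: cvg_cst.
  apply: cvg_trans cB; apply: near_eq_cvg.
  near=> h => /=; have h0 : h != 0 by near: h; exact: nbhs_dnbhs_neq.
  by rewrite addr0 scale0r addr0 addrAC subrr add0r [h *: 1]mulr1 scalerA mulVf// scale1r.
apply: DeriveDef; first by apply/cvg_ex; exists B.
exact: (cvg_lim _ c).
Unshelve. all: by end_near.
Qed.

(* Such a curve moves neither the first point of the frame nor the line through
   its first two points. *)
Lemma E_plus_elementary p i j : j != i -> j != 0 -> i != 2%:R ->
  E_plus (tvec p (val p *m delta_mx i j)).
Proof.
move=> ji j0 i2.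
have cU (t : R) : [set p : 'M[R]_3 | p \in unitmx] (val p *m (1%:M + t *: delta_mx i j)).
  by rewrite /= unitmx_mul GL3_unitmx elementary_unitmx.
exists (fun t => set_pt (cU t)), (val p *m delta_mx i j); split.
- rewrite [X in is_derive _ _ X _](_ : _ = (fun t : R => val p + t *: (val p *m delta_mx i j))).
    exact: is_derive_affine.
  by apply/funext => t /=; rewrite mulmxDr mulmx1 -scalemxAr.
- have H (t : R) : pi_plus (frame (set_pt (cU t))) = pi_plus (frame p).
    rewrite !pi_plus_frame; congr (pclass _, pclass _) => /=.
      rewrite mulmxDr mulmx1 -scalemxAr; apply/colP => a; rewrite !mxE.
      rewrite big1 ?mulr0 ?addr0// => b _.
      by rewrite !mxE [0 == _]eq_sym (negPf j0) andbF mulr0.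
    rewrite invmx_mul ?GL3_unitmx ?elementary_unitmx//.
    have -> : invmx (1%:M + t *: delta_mx i j) = 1%:M - t *: delta_mx i j :> 'M[R]_3.
      apply: (can_inj (mulKmx (elementary_unitmx t ji))).
      by rewrite mulmxV ?elementary_unitmx// elementary_mulV.
    rewrite mulmxBl mul1mx -scalemxAl; apply/rowP => a; rewrite !mxE.
    rewrite big1 ?mulr0 ?subr0// => b _.
    by rewrite !mxE eq_sym (negPf i2) mul0r.
  by apply: (@filterE _ _ (nbhs_filter (0 : R))) => t; exact: etrans (H t) (esym (H 0)).
- have e : set_pt (cU 0) = p by apply: val_inj; rewrite /= scale0r addr0 mulmx1.
  by rewrite e.
Qed.

End ElementaryCurves.

Section CartanDecomposition.
Variable R : realType.

Lemma geodN (t : R) : geod (- t) = (geod t)^-1%g.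
Proof.
apply: (mulgI (geod t)); rewrite mulgV; apply: val_inj.
rewrite -[LHS]/(diag_exp t *m diag_exp (- t)) -[RHS]/(1%:M : 'M[R]_2).
rewrite /diag_exp mulmx_diag -diag_const_mx.
congr diag_mx; apply/rowP => j; rewrite !mxE opprK.
by case: ifP => _; rewrite -expRD ?subrr ?addNr expR0.
Qed.

Lemma det2 (A : 'M[R]_2) : \det A = A 0 0 * A 1 1 - A 0 1 * A 1 0.
Proof.
rewrite (expand_det_row _ 0) !big_ord_recl big_ord0 addr0 /cofactor !det_mx11 !mxE /=.
have e1 : lift 0 0 = 1 :> 'I_2 by exact: val_inj.
have e2 : lift 1 0 = 0 :> 'I_2 by exact: val_inj.
rewrite !e1 !e2.
by rewrite expr0 expr1 mul1r mulN1r mulrN.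
Qed.

(** The roots of the characteristic polynomial have product 1 and sum at least 2, so the larger one,
    [lam], is at least 1. *)
Lemma symmetric_eigenvector (a b d : R) : a * d - b ^+ 2 = 1 -> 0 <= a + d ->
  exists x y t : R, [/\ 0 <= t, x ^+ 2 + y ^+ 2 = 1,
    a * x + b * y = expR (2 * t) * x & b * x + d * y = expR (2 * t) * y].
Proof.
move=> det1 s0; pose r := Num.sqrt ((a + d) ^+ 2 - 4).
have s4 : 0 <= (a + d) ^+ 2 - 4.
  have -> : (a + d) ^+ 2 - 4 = (a - d) ^+ 2 + (2 * b) ^+ 2.
    by transitivity ((a + d) ^+ 2 - 4 * (a * d - b ^+ 2)); [rewrite det1 mulr1|ring].
  by rewrite addr_ge0// sqr_ge0.
have rE : r ^+ 2 = (a + d) ^+ 2 - 4 by rewrite sqr_sqrtr.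
pose lam := (a + d + r) / 2.
have r0 : 0 <= r := sqrtr_ge0 _.
have s2 : 2 <= a + d by rewrite -(@ler_pXn2r _ 2) ?nnegrE//; lra.
have lam1 : 1 <= lam by rewrite /lam; lra.
have lamE : lam ^+ 2 - (a + d) * lam + 1 = 0.
  have -> : lam ^+ 2 - (a + d) * lam + 1 = (r ^+ 2 - ((a + d) ^+ 2 - 4)) / 4.
    by rewrite /lam; field.
  by rewrite rE subrr mul0r.
(* [lam] is to be the square of a singular value, hence the half. *)
pose t := ln lam / 2.
have tE : expR (2 * t) = lam by rewrite /t mulrC divfK// lnK// posrE; lra.
suff [x [y [xy e1 e2]]] : exists x y : R, [/\ 0 < x ^+ 2 + y ^+ 2,
    a * x + b * y = lam * x & b * x + d * y = lam * y].
  pose n := Num.sqrt (x ^+ 2 + y ^+ 2).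
  have n0 : n != 0 by rewrite gt_eqF// sqrtr_gt0.
  exists (x / n), (y / n), t; split.
  - by rewrite divr_ge0// ln_ge0.
  - by rewrite !exprMn -mulrDl exprVn sqr_sqrtr ?ltW// divff// gt_eqF.
  - by rewrite tE; transitivity ((a * x + b * y) / n); [ring|rewrite e1; ring].
  - by rewrite tE; transitivity ((b * x + d * y) / n); [ring|rewrite e2; ring].
(* For nonzero [b] the first row of the eigenvalue equation gives the vector; otherwise the matrix
   is diagonal and a basis vector works. *)
have [b0|b0] := eqVneq b 0; last first.
  exists b, (lam - a); split.
  - by rewrite ltr_pwDl ?sqr_ge0// exprn_even_gt0.
  - by ring.
  - apply/eqP; rewrite -subr_eq0; apply/eqP.
    by transitivity (- (lam ^+ 2 - (a + d) * lam + (a * d - b ^+ 2))); [ring|rewrite det1 lamE oppr0].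
have [la|la] := eqVneq lam a.
  by exists 1, 0; split; [rewrite expr1n expr0n addr0|rewrite la; ring|rewrite b0; ring].
exists 0, 1; split; [by rewrite expr1n expr0n add0r|by rewrite b0; ring|].
have : (lam - a) * (lam - d) = 0.
  by transitivity (lam ^+ 2 - (a + d) * lam + (a * d - b ^+ 2)); [rewrite b0; ring|rewrite det1 lamE].
move/eqP; rewrite mulf_eq0 !subr_eq0 (negPf la) /= => /eqP <-.
by rewrite b0; ring.
Qed.

Definition mx2 (a b c d : R) : 'M[R]_2 :=
  \matrix_(i, j) (if i == 0 then if j == 0 then a else b else if j == 0 then c else d).

Lemma ord2_ind (P : 'I_2 -> Prop) : P 0 -> P 1 -> forall i, P i.
Proof.
by move=> P0 P1 [[|[|//]] i2]; [rewrite (_ : Ordinal i2 = 0)|rewrite (_ : Ordinal i2 = 1)];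
  rewrite //; exact: val_inj.
Qed.

Lemma sqr_sum1_le1 (x y : R) : x ^+ 2 + y ^+ 2 = 1 -> `|x| <= 1 /\ `|y| <= 1.
Proof.
move=> xy; have xle : x ^+ 2 <= 1 by rewrite -xy lerDl sqr_ge0.
have yle : y ^+ 2 <= 1 by rewrite -xy lerDr sqr_ge0.
by split; rewrite -(@ler_pXn2r _ 2) ?nnegrE// expr1n real_normK ?num_real.
Qed.

(* The right singular vectors of [g] are the eigenvectors of [g^T *m g]. *)
Lemma cartan_decomposition (g : SL R 2) : exists (k l : SL R 2) (t : R),
  [/\ 0 <= t, g = (k * geod t * l^-1)%g,
      forall i j, `|val k i j| <= 1, forall i j, `|val l i j| <= 1
    & forall i j, `|val (l^-1)%g i j| <= 1].
Proof.
pose g_ i j := val g i j.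
have g1 : g_ 0 0 * g_ 1 1 - g_ 0 1 * g_ 1 0 = 1 by rewrite -det2 SL_det.
pose a := g_ 0 0 ^+ 2 + g_ 1 0 ^+ 2; pose b := g_ 0 0 * g_ 0 1 + g_ 1 0 * g_ 1 1.
pose d := g_ 0 1 ^+ 2 + g_ 1 1 ^+ 2.
have abd : a * d - b ^+ 2 = 1.
  by transitivity ((g_ 0 0 * g_ 1 1 - g_ 0 1 * g_ 1 0) ^+ 2); [rewrite /a /b /d; ring|rewrite g1 expr1n].
have ad0 : 0 <= a + d by rewrite !addr_ge0// sqr_ge0.
have [x [y [t [t0 xy e1 e2]]]] := symmetric_eigenvector abd ad0.
have [x1 y1] := sqr_sum1_le1 xy.
(* The rotation whose first column is the eigenvector; [l'] is its inverse. *)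
have lD : [set g : 'M[R]_2 | \det g = 1] (mx2 x (- y) y x).
  by rewrite /= det2 !mxE /= -xy; ring.
have lVD : [set g : 'M[R]_2 | \det g = 1] (mx2 x y (- y) x).
  by rewrite /= det2 !mxE /= -xy; ring.
pose l : SL R 2 := set_pt lD; pose l' : SL R 2 := set_pt lVD.
have ll' : (l * l')%g = 1%g.
  apply: val_inj; rewrite -[LHS]/(mx2 x (- y) y x *m mx2 x y (- y) x) -[RHS]/(1%:M : 'M[R]_2).
  apply/matrixP; apply: ord2_ind; apply: ord2_ind;
    rewrite !mxE !big_ord_recl big_ord0 !mxE /= ?mulr1n ?mulr0n; rewrite -?xy; ring.
have lV : (l^-1)%g = l' by apply: (mulgI l); rewrite mulgV ll'.
pose k := (g * l * (geod t)^-1)%g.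
have kE i : val k i 0 = (g_ i 0 * x + g_ i 1 * y) * expR (- t) /\
            val k i 1 = (g_ i 1 * x - g_ i 0 * y) * expR t.
  rewrite /k -geodN -[val _]/(val g *m mx2 x (- y) y x *m diag_exp (- t)).
  rewrite /diag_exp mul_mx_diag !mxE !big_ord_recl !big_ord0 !mxE /= opprK.
  have l01 : lift 0 0 = 1 :> 'I_2 by exact: val_inj.
  by rewrite !l01 -[ord0]/(0 : 'I_2) /g_; split; ring.
(* The first column of [k] is the image of the eigenvector divided by its length e^t. The second is
   a unit vector because the product of the two eigenvalues is 1. *)
have k1 j : val k 0 j ^+ 2 + val k 1 j ^+ 2 = 1.
  have et : expR (- t) ^+ 2 * expR (2 * t) = 1.
    by rewrite -expRM_natl -expRD mulrN addNr expR0.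
  have et' : expR t ^+ 2 = expR (2 * t) by rewrite -expRM_natl.
  have lamE : expR (2 * t) = a * x ^+ 2 + 2 * b * x * y + d * y ^+ 2.
    transitivity (expR (2 * t) * (x ^+ 2 + y ^+ 2)); first by rewrite xy mulr1.
    transitivity (x * (expR (2 * t) * x) + y * (expR (2 * t) * y)); first by ring.
    by rewrite -e1 -e2; ring.
  move: j; apply: ord2_ind; rewrite ?(kE 0).1 ?(kE 1).1 ?(kE 0).2 ?(kE 1).2.
    by rewrite -[RHS]et lamE /a /b /d; ring.
  transitivity (expR t ^+ 2 * (a * y ^+ 2 - 2 * b * x * y + d * x ^+ 2)).
    by rewrite /a /b /d; ring.
  rewrite et' lamE.
  transitivity ((a * d - b ^+ 2) * (x ^+ 2 + y ^+ 2) ^+ 2 +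
      (x * (b * x + d * y) - y * (a * x + b * y)) ^+ 2); first by ring.
  by rewrite abd xy e1 e2; ring.
have mx2_le1 (u v w z : R) : `|u| <= 1 -> `|v| <= 1 -> `|w| <= 1 -> `|z| <= 1 ->
    forall i j, `|mx2 u v w z i j| <= 1.
  by move=> u1 v1 w1 z1; apply: ord2_ind; apply: ord2_ind; rewrite mxE.
exists k, l, t; split => //.
- by rewrite /k mulgVK mulgK.
- apply: ord2_ind => j; first by case: (sqr_sum1_le1 (k1 j)).
  by case: (sqr_sum1_le1 (k1 j)).
- by apply: mx2_le1; rewrite ?normrN.
- by rewrite lV; apply: mx2_le1; rewrite ?normrN.
Qed.

Lemma weyl_subproof : [set g : 'M[R]_2 | \det g = 1] (mx2 0 (-1) 1 0).
Proof. by rewrite /= det2 !mxE /=; ring. Qed.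

Definition weyl : SL R 2 := set_pt weyl_subproof.

Lemma weyl_geod t : (weyl * geod t = (geod t)^-1 * weyl)%g.
Proof.
rewrite -geodN; apply: val_inj.
rewrite -[LHS]/(mx2 0 (-1) 1 0 *m diag_exp t) -[RHS]/(diag_exp (- t) *m mx2 0 (-1) 1 0).
rewrite /diag_exp mul_mx_diag mul_diag_mx opprK.
by apply/matrixP; apply: ord2_ind; apply: ord2_ind; rewrite !mxE /=; ring.
Qed.

End CartanDecomposition.

(** * Dynamics of the representation *)

Lemma cvg_expRN (R : realType) (T : Type) (F : set_system T) {FF : Filter F} (t : T -> R) (a : R) :
  0 < a -> (forall C, \forall x \near F, C < t x) ->
  expR (- (a * t x)) @[x --> F] --> (0 : R).
Proof.
move=> a0 tC; apply/cvgr0Pnorm_lt => e e0.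
apply: filterS (tC (- ln e / a)) => x xC.
rewrite gtr0_norm ?expR_gt0// -[ltRHS]lnK ?posrE// ltr_expR ltrNl.
by rewrite -ltr_pdivrMl// mulrC.
Qed.

Section Domination.
Variables (R : realType) (Gam : groupType).
Variables (iota : {multiplicative Gam -> SL R 2}) (rho : {multiplicative Gam -> SL R 3}).
Hypothesis iota_inj : injective iota.
Hypothesis iota_discrete : discrete_subset (range iota).
Variables (s : M iota -> Erho iota rho) (f : SL R 2 -> Y R).
Hypothesis s_anosov : anosov_section s.
Hypothesis f_lifts_s : lifts f s.
Local Notation vnorm := (vnorm iota rho).
Local Notation vnormM := (vnormM iota rho).
Local Notation vnormZ := (vnormZ rho iota_inj iota_discrete).
Local Notation vnorm_gt0 := (vnorm_gt0 rho iota_inj iota_discrete).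
Local Notation cvg_vnorm := (cvg_vnorm iota_inj iota_discrete).

(** The Anosov contraction is applied to the elementary directions in [E_plus], measured in the
    invariant norm; the flow moves [h] and keeps the frame. *)
Lemma anosov_domination : exists a b : R, [/\ 0 < a, 0 < b &
  forall h (p : GL3 R) t (i j : 'I_3), frame p = f h -> 0 < t ->
    j != i -> j != 0 -> i != 2%:R ->
    vnorm (h * geod t)%g (col i (val p)) / vnorm (h * geod t)%g (col j (val p)) <=
    b * expR (- (a * t)) * (vnorm h (col i (val p)) / vnorm h (col j (val p)))].
Proof.
have [_ _ _ /(_ _ (VE_norm_continuous_norm rho iota_inj iota_discrete))] := s_anosov.
move=> [a [b [a0 b0 H]]]; exists a, b; split=> // h p t i j ph t0 ji j0 i2.
pose v := tvec p (val p *m delta_mx i j).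
have [|+ _] := H t (classVE iota rho h v) t0.
  by exists (classM iota h) => //; rewrite f_lifts_s baseVE_classVE baseY_tvec ph.
have fE h' := frame_norm_delta iota rho h' p ji.
rewrite /v flowVE_classVE !(VE_norm_class rho iota_inj iota_discrete) => Hd.
rewrite -(fE h) -(fE (h * geod t)%g); apply: Hd.
by exists h, v => //; exact: E_plus_elementary.
Qed.

Let f_cont : continuous f.
Proof.
by have [s_cont _ _ _] := s_anosov; exact: (lift_continuous iota_inj iota_discrete f_lifts_s).
Qed.

Let f_equiv g h : f (iota g * h)%g = actY (rho g) (f h).
Proof. exact: (lift_equivariant iota_inj f_lifts_s). Qed.

Let f_flow t h : f (h * geod t)%g = f h.
Proof. by have [_ s_sec s_flow _] := s_anosov; exact: (lift_flow iota_inj s_sec f_lifts_s). Qed.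

Lemma attracting_repelling_limits (T : Type) (F : set_system T) (g : T -> Gam)
    (k l : T -> SL R 2) (t : T -> R) (k0 l0 : SL R 2) :
  UltraFilter F -> (forall x, iota (g x) = k x * geod (t x) * (l x)^-1)%g ->
  k @ F --> k0 -> l @ F --> l0 -> (forall C, \forall x \near F, C < t x) ->
  exists (p q : GL3 R) (c c' : T -> R),
    [/\ frame p = f k0, frame q = f l0, forall x, c x != 0 /\ c' x != 0,
       c x *: val (rho (g x)) @[x --> F] -->
         val p *m delta_mx 0 0 *m invmx (val q)
     & c' x *: invmx (val (rho (g x))) @[x --> F] -->
         val q *m delta_mx 2%:R 2%:R *m invmx (val p)].
Proof.
move=> FU gE kk ll t_oo.
have [p_ [p [p_f p_1 pf pp]]] := frame_lift_cvg FU (cvg_comp _ _ kk (@f_cont k0)).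
have [q_ [q [q_f q_1 qf qq]]] := frame_lift_cvg FU (cvg_comp _ _ ll (@f_cont l0)).
have kgl x : (k x * geod (t x) = iota (g x) * l x)%g by rewrite gE mulgVK.
(* By equivariance and invariance under the flow, [rho (g x)] sends [f (l x)] to [f (k x)], hence is
   diagonal between the two lifted bases. *)
have dE x : exists d : 'rV[R]_3, (forall j, d 0 j != 0) /\
    val (rho (g x)) *m val (q_ x) = val (p_ x) *m diag_mx d.
  apply: (@frame_eqP _ (p_ x) (actGL (rho (g x)) (q_ x))).
  by rewrite frame_actGL p_f q_f /= -f_equiv -kgl f_flow.
pose d x := sval (cid (dE x)).
have d0 x j : d x 0 j != 0 by rewrite /d; case: cid => ? [].
have rho_col x j : val (rho (g x)) *m col j (val (q_ x)) = d x 0 j *: col j (val (p_ x)).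
  rewrite colE mulmxA; have -> : val (rho (g x)) *m val (q_ x) = val (p_ x) *m diag_mx (d x).
    by rewrite /d; case: cid => ? [].
  by rewrite -colE mul_mx_diag; apply/colP => i; rewrite !mxE mulrC.
have rhoE x : val (rho (g x)) = val (p_ x) *m diag_mx (d x) *m invmx (val (q_ x)).
  rewrite -[LHS](mulmxK (GL3_unitmx (q_ x))); congr (_ *m _).
  by rewrite /d; case: cid => ? [].
have [a [b [a0 b0 dom]]] := anosov_domination.
have vp j : vnorm (k x) (col j (val (p_ x))) @[x --> F] --> vnorm k0 (col j (val p)).
  exact: (cvg_vnorm kk (cvg_col pp)).
have vq j : vnorm (l x) (col j (val (q_ x))) @[x --> F] --> vnorm l0 (col j (val q)).
  exact: (cvg_vnorm ll (cvg_col qq)).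
have v0 h (r : GL3 R) j : 0 < vnorm h (col j (val r)) by rewrite vnorm_gt0// col_neq0.
have ratio (i j : 'I_3) : j != i -> j != 0 -> i != 2%:R -> d x 0 j / d x 0 i @[x --> F] --> (0 : R).
  move=> ji j0 i2; apply/norm_cvg0P.
  (* The two ratios of norms converge because the frames and base points do, so the exponential
     drives the bound to 0. *)
  pose B x := b * expR (- (a * t x)) *
    (vnorm (k x) (col i (val (p_ x))) / vnorm (k x) (col j (val (p_ x)))) *
    (vnorm (l x) (col j (val (q_ x))) / vnorm (l x) (col i (val (q_ x)))).
  have B0 : B @ F --> (0 : R).
    rewrite /B -(mul0r (vnorm l0 (col j (val q)) / vnorm l0 (col i (val q)))).
    apply: cvgM; last by apply: cvgM => //; apply: cvgV => //; rewrite gt_eqF.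
    rewrite -(mul0r (vnorm k0 (col i (val p)) / vnorm k0 (col j (val p)))).
    apply: cvgM; last by apply: cvgM => //; apply: cvgV => //; rewrite gt_eqF.
    by rewrite -(mulr0 b); apply: cvgM; [exact: cvg_cst|exact: cvg_expRN].
  apply: (squeeze_cvgr _ (cvg_cst 0) B0); apply: filterS (t_oo 0) => x t0.
  rewrite normr_ge0 /=.
  have := dom (k x) (p_ x) (t x) i j (p_f x) t0 ji j0 i2.
  (* Column [m] of [p_ x] is the image of that of [q_ x] divided by d_m, and invariance brings the
     norm at [iota (g x) * l x] back to [l x]. *)
  have vE m : vnorm (k x * geod (t x))%g (col m (val (p_ x))) =
      `|d x 0 m|^-1 * vnorm (l x) (col m (val (q_ x))).
    rewrite -[col m (val (p_ x))]scale1r -(mulVf (d0 x m)) -scalerA -rho_col.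
    by rewrite vnormZ normfV kgl vnormM.
  rewrite !vE => le1; rewrite /B.
  rewrite -[leLHS]divr1 -(divff (lt0r_neq0 (v0 (l x) (q_ x) i))).
  have ni : 0 < `|d x 0 i| by rewrite normr_gt0.
  have nj : 0 < `|d x 0 j| by rewrite normr_gt0.
  have vi := v0 (l x) (q_ x) i; have vj := v0 (l x) (q_ x) j.
  rewrite -ler_pdivrMr ?divr_gt0//; apply: le_trans le1.
  rewrite le_eqVlt; apply/orP; left; apply/eqP; rewrite normrM normfV; field.
  by rewrite !gt_eqF.
have r01 : d x 0 1 / d x 0 0 @[x --> F] --> (0 : R) by exact: ratio.
have r12 : d x 0 2%:R / d x 0 1 @[x --> F] --> (0 : R) by exact: ratio.
have r02 : d x 0 2%:R / d x 0 0 @[x --> F] --> (0 : R) by exact: ratio.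
have qq' : invmx (val (q_ x)) @[x --> F] --> invmx (val q).
  by apply: cvg_invmx => //; [move=> x; exact: GL3_unitmx|exact: GL3_unitmx].
have pp' : invmx (val (p_ x)) @[x --> F] --> invmx (val p).
  by apply: cvg_invmx => //; [move=> x; exact: GL3_unitmx|exact: GL3_unitmx].
(* Dividing by the dominant entry d_0, or multiplying the inverse by d_2, leaves a single diagonal
   entry 1 in the limit. *)
exists p, q, (fun x => (d x 0 0)^-1), (fun x => d x 0 2%:R); split=> //.
- by move=> x; rewrite invr_eq0.
- have E x : (d x 0 0)^-1 *: val (rho (g x)) =
      val (p_ x) *m diag_mx (\row_j (d x 0 j / d x 0 0)) *m invmx (val (q_ x)).
    rewrite rhoE scalemxAl scalemxAr; congr (_ *m _ *m _).
    by rewrite -linearZ; congr diag_mx; apply/rowP => j; rewrite !mxE mulrC.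
  under eq_fun do rewrite E.
  apply: cvg_mulmx qq'; apply: cvg_mulmx => //.
  apply/cvg_mxP => i j; rewrite mxE; under eq_fun do rewrite !mxE.
  case: (eqVneq i j) => [->|ij]; last first.
    have -> : (i == 0) && (j == 0) = false.
      by apply/negP => /andP[/eqP i0 /eqP j0]; rewrite i0 j0 eqxx in ij.
    by under eq_fun do rewrite mulr0n; exact: cvg_cst.
  rewrite andbb; under eq_fun do rewrite mulr1n.
  move: j {i}; apply: ord3_ind => //=; under eq_fun do rewrite divff//.
  exact: cvg_cst.
- have E x : d x 0 2%:R *: invmx (val (rho (g x))) =
      val (q_ x) *m diag_mx (\row_j (d x 0 2%:R / d x 0 j)) *m invmx (val (p_ x)).
    have dU : diag_mx (d x) \in unitmx.
      by rewrite unitmxE det_diag unitfE; apply/prodf_neq0.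
    have inv_d : invmx (diag_mx (d x)) = diag_mx (\row_j (d x 0 j)^-1).
      apply: (can_inj (mulKmx dU)); rewrite mulmxV// mulmx_diag -diag_const_mx.
      by congr diag_mx; apply/rowP => j; rewrite !mxE divff.
    rewrite rhoE !invmx_mul ?unitmx_inv ?unitmx_mul ?GL3_unitmx ?dU// invmxK inv_d mulmxA.
    rewrite scalemxAl scalemxAr; congr (_ *m _ *m _).
    by rewrite -linearZ; congr diag_mx; apply/rowP => j; rewrite !mxE.
  under eq_fun do rewrite E.
  apply: cvg_mulmx pp'; apply: cvg_mulmx => //.
  apply/cvg_mxP => i j; rewrite mxE; under eq_fun do rewrite !mxE.
  case: (eqVneq i j) => [->|ij]; last first.
    have -> : (i == 2%:R) && (j == 2%:R) = false.
      by apply/negP => /andP[/eqP i0 /eqP j0]; rewrite i0 j0 eqxx in ij.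
    by under eq_fun do rewrite mulr0n; exact: cvg_cst.
  rewrite andbb; under eq_fun do rewrite mulr1n.
  move: j {i}; apply: ord3_ind => //=; under eq_fun do rewrite divff//.
  exact: cvg_cst.
Qed.

End Domination.

(** * Projective limits and rank-one operators *)

Lemma proj_lift_cvg (R : realType) m n (T : Type) (F : set_system T)
    (X : T -> Defs.proj R m n) (x : Defs.proj R m n) :
  UltraFilter F -> X @ F --> x ->
  exists (u : T -> 'M[R]_(m.+1, n.+1)) (u0 : 'M[R]_(m.+1, n.+1)),
    [/\ forall y, u y != 0, forall y, pclass (u y) = X y, u @ F --> u0,
        u0 != 0 & pclass u0 = x].
Proof.
move=> FU Xx; pose u y := `|prepr (X y)|^-1 *: prepr (X y).
have n0 y : `|prepr (X y)| != 0 by rewrite normr_eq0; exact: prepr_neq0.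
have u1 y : `|u y| = 1 by rewrite normrZ normfV normr_id mulVf.
have [u0 uu0] : exists u0 : 'M[R]_(m.+1, n.+1), u @ F --> u0.
  apply: (@ultrafilter_mx_cvg _ _ _ _ _ _ 1); apply: filterE => y i j.
  by rewrite -(u1 y); exact: le_mx_norm.
have u00 : u0 != 0.
  have c : `|u y| @[y --> F] --> `|u0| by exact: cvg_norm.
  have c1 : `|u y| @[y --> F] --> (1 : R) by under eq_fun do rewrite u1; exact: cvg_cst.
  by rewrite -normr_eq0 (cvg_unique _ c c1) //= oner_eq0.
have uX y : pclass (u y) = X y by rewrite pclassZ ?preprK ?invr_eq0 ?prepr_neq0.
exists u, u0; split=> // [y|].
  by rewrite scaler_eq0 invr_eq0 negb_or n0 prepr_neq0.
apply: (@proj_cvg_unique _ _ _ _ F _ X) => //.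
have XE : X = fun y => pclass (u y) by apply/funext => y; rewrite uX.
by rewrite XE; exact: cvg_pclass.
Qed.

(** Scaling does not change projective classes, so [A] and [B] both represent the limit of the
    classes of [X x]. *)
Lemma scaled_limits (R : realType) m n (T : Type) (F : set_system T) {FF : ProperFilter F}
    (X : T -> 'M[R]_(m.+1, n.+1)) (c d : T -> R) (A B : 'M[R]_(m.+1, n.+1)) :
  (forall x, X x != 0) -> (forall x, c x != 0) -> (forall x, d x != 0) ->
  A != 0 -> B != 0 ->
  c x *: X x @[x --> F] --> A -> d x *: X x @[x --> F] --> B ->
  exists2 e : R, e != 0 & B = e *: A.
Proof.
move=> X0 c0 d0 A0 B0 cA dB; apply/pclassP => //.
apply: (@proj_cvg_unique _ _ _ _ F _ (fun x => pclass (X x))).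
  have XE : (fun x => pclass (X x)) = fun x => pclass (c x *: X x).
    by apply/funext => x; rewrite pclassZ.
  by rewrite XE; exact: cvg_pclass.
have XE : (fun x => pclass (X x)) = fun x => pclass (d x *: X x).
  by apply/funext => x; rewrite pclassZ.
by rewrite XE; exact: cvg_pclass.
Qed.

Lemma SL_bounded_cvg (R : realType) n (T : Type) (F : set_system T) (k : T -> SL R n) :
  UltraFilter F -> (forall x i j, `|val (k x) i j| <= 1) ->
  exists k0 : SL R n, k @ F --> k0.
Proof.
move=> FU k1; have [A kA] : exists A : 'M[R]_n, (fun x => val (k x)) @ F --> A.
  by apply: (@ultrafilter_mx_cvg _ _ _ _ _ _ 1); apply: filterE.
have A1 : \det A = 1.
  have c1 : \det (val (k x)) @[x --> F] --> (1 : R).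
    by under eq_fun do rewrite SL_det; exact: cvg_cst.
  exact: (cvg_unique _ (cvg_det kA) c1).
exists (set_pt (A1 : [set g : 'M[R]_n | \det g = 1] A)).
exact/cvg_initial.
Qed.

Lemma mx_norm_le (R : realType) m n (A : 'M[R]_(m, n)) C :
  0 <= C -> (forall i j, `|A i j| <= C) -> `|A| <= C.
Proof.
move=> C0 AC; rewrite [leLHS]/Num.norm /= mx_normrE.
by apply: bigmax_le => [|[i j] _] /=.
Qed.

Section RankOne.
Variable R : realType.
Implicit Types p q : GL3 R.

Lemma rank_oneE p q j :
  val p *m delta_mx j j *m invmx (val q) = col j (val p) *m row j (invmx (val q)).
Proof.
by rewrite colE rowE -!mulmxA [delta_mx j 0 *m _]mulmxA mul_delta_mx.
Qed.

Lemma rank_one_neq0 p q j : col j (val p) *m row j (invmx (val q)) != 0.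
Proof.
apply/eqP => /(congr1 (mulmx^~ (col j (val q)))); rewrite /= -mulmxA row_invmx_col.
by rewrite eqxx mulmx1 mul0mx => /eqP; rewrite (negPf (col_neq0 _ _)).
Qed.

Lemma col_mulmx11 n (u : 'cV[R]_n) (A : 'M[R]_1) : u *m A = A 0 0 *: u.
Proof. by rewrite {1}[A]mx11_scalar mul_mx_scalar. Qed.

Lemma row_mulmx11 n (A : 'M[R]_1) (l : 'rV[R]_n) : A *m l = A 0 0 *: l.
Proof. by rewrite {1}[A]mx11_scalar mul_scalar_mx. Qed.

Lemma mx11_neq0 (A : 'M[R]_1) : (A != 0) = (A 0 0 != 0).
Proof.
congr (~~ _); apply/eqP/eqP => [->|A0]; first by rewrite mxE.
by rewrite [A]mx11_scalar A0 raddf0.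
Qed.

(** [u] lies in the span of the first two vectors of [p]. If its second coordinate is zero, its
    point is that of [p]; if not, [l] also kills the second vector, and its line is that of [p]. *)
Lemma flag_meet p (u : 'cV[R]_3) (l : 'rV[R]_3) : u != 0 -> l != 0 -> l *m u = 0 ->
  row 2%:R (invmx (val p)) *m u = 0 -> l *m col 0 (val p) = 0 ->
  pclass u = pclass (col 0 (val p)) :> PV R \/
  pclass l = pclass (row 2%:R (invmx (val p))) :> PVd R.
Proof.
move=> u0 l0 lu p2u lp0.
have sum3 (V : zmodType) (x : 'I_3 -> V) : \sum_j x j = x 0 + x 1 + x 2%:R.
  rewrite !big_ord_recl big_ord0 addr0 addrA.
  by congr (_ + x _ + x _); exact: val_inj.
have z0 : (0 : 'M[R]_1) 0 0 = 0 by rewrite mxE.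
pose al := (row 0 (invmx (val p)) *m u) 0 0; pose be := (row 1 (invmx (val p)) *m u) 0 0.
have uE : u = al *: col 0 (val p) + be *: col 1 (val p).
  by rewrite [LHS](col_frameE p) sum3 p2u z0 scale0r addr0.
have [be0|be0] := eqVneq be 0.
  have uE' : u = al *: col 0 (val p) by rewrite uE be0 scale0r addr0.
  left; rewrite uE' pclassZ ?col_neq0//; apply: contra_neq u0 => al0.
  by rewrite uE' al0 scale0r.
have lp1 : l *m col 1 (val p) = 0.
  move: lu; rewrite uE mulmxDr -!scalemxAr lp0 scaler0 add0r => /eqP.
  by rewrite scaler_eq0 (negPf be0) => /eqP.
have lE : l = (l *m col 2%:R (val p)) 0 0 *: row 2%:R (invmx (val p)).
  by rewrite [LHS](row_frameE p) sum3 lp0 lp1 z0 !scale0r !add0r.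
right; rewrite lE pclassZ ?row_invmx_neq0//; apply: contra_neq l0 => c0.
by rewrite lE c0 scale0r.
Qed.

Lemma actVdK (g : SL R 3) : cancel (actVd g) (actVd g^-1%g).
Proof.
move=> l; have l0 := prepr_neq0 l; have gU := SL_unitmx g.
rewrite -{1}[l]preprK actVd_pclass// actVd_pclass.
  by rewrite /= invmxK mulmxKV// preprK.
by apply: contra_neq l0 => lg0; rewrite -(mulmxKV gU (prepr l)) lg0 mul0mx.
Qed.

Lemma actVK (g : SL R 3) : cancel (actV g) (actV g^-1%g).
Proof. by move=> x; rewrite -actVM mulVg actV1. Qed.

Lemma flags_actF (g : SL R 3) x : flags x -> flags (actF g x).
Proof.
case: x => x l; rewrite /flags /= -{1}[x]preprK -{1}[l]preprK => /incidentP.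
have [x0 l0] := (prepr_neq0 x, prepr_neq0 l); have gU := SL_unitmx g.
move=> /(_ x0 l0) lx; apply/incidentP.
- exact: unitmx_neq0.
- by apply: contra_neq l0 => lg0; rewrite -(mulmxKV gU (prepr l)) lg0 mul0mx.
- by rewrite mulmxA mulmxKV.
Qed.

End RankOne.

Section ActF.
Variable R : realType.

Lemma actF1 (x : PV R * PVd R) : actF 1%g x = x.
Proof. by rewrite /actF actV1 /actVd /= invmx1 mulmx1 preprK -surjective_pairing. Qed.

Lemma actFM (g h : SL R 3) x : actF (g * h)%g x = actF g (actF h x).
Proof.
rewrite /actF /= actVM; congr (_, _).
have lh0 : prepr x.2 *m invmx (val h) != 0.
  apply: contra_neq (prepr_neq0 x.2) => lh0.
  by rewrite -(mulmxKV (SL_unitmx h) (prepr x.2)) lh0 mul0mx.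
rewrite [actVd h _]/actVd actVd_pclass// /actVd -mulmxA.
by rewrite /= invmx_mul ?SL_unitmx.
Qed.

End ActF.

(** * Proper discontinuity and freeness on the domain *)

Section Main.
Variables (R : realType) (Gam : groupType).
Variables (iota : {multiplicative Gam -> SL R 2}) (rho : {multiplicative Gam -> SL R 3}).
Hypothesis iota_inj : injective iota.
Hypothesis iota_discrete : discrete_subset (range iota).
Variables (s : M iota -> Erho iota rho) (f : SL R 2 -> Y R).
Hypothesis s_anosov : anosov_section s.
Hypothesis f_lifts_s : lifts f s.

Lemma limit_frame (p : GL3 R) h : frame p = f h ->
  limit_points f (pclass (col 0 (val p))) /\
  limit_lines f (pclass (row 2%:R (invmx (val p)))).
Proof.
move=> pf; have mem : limit_curve f (pi_plus (frame p)).
  by exists (frame p) => //; exists h.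
by split; exists (pi_plus (frame p)) => //; rewrite pi_plus_frame.
Qed.

Lemma limit_curve_act g x : limit_curve f x -> limit_curve f (actF (rho g) x).
Proof.
case=> _ [h _ <-] <-; exists (f (iota g * h)%g); first by exists (iota g * h)%g.
by rewrite (lift_equivariant iota_inj f_lifts_s) pi_plus_actY.
Qed.

Lemma domain_act g x : domain f x -> domain f (actF (rho g) x).
Proof.
case=> fx npt nln; split; first exact: flags_actF.
- move=> [y Ly yx]; apply: npt; exists (actF (rho g^-1%g) y); first exact: limit_curve_act.
  by rewrite /= yx multiplicativeV actVK.
- move=> [y Ly yx]; apply: nln; exists (actF (rho g^-1%g) y); first exact: limit_curve_act.
  by rewrite /= yx multiplicativeV actVdK.
Qed.

Lemma cartan_escape (T : Type) (F : set_system T) (g : T -> Gam) (k l : T -> SL R 2)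
    (t : T -> R) : Filter F ->
  (forall B, finite_set B -> \forall x \near F, ~ B (g x)) ->
  (forall x, [/\ 0 <= t x, iota (g x) = (k x * geod (t x) * (l x)^-1)%g,
     forall i j, `|val (k x) i j| <= 1
   & forall i j, `|val ((l x)^-1)%g i j| <= 1]) ->
  forall C, \forall x \near F, C < t x.
Proof.
move=> FF g_oo kl C.
(* [k x] and the inverse of [l x] have norm at most 1 and two products cost 2 each, so t at most [C]
   would confine [iota (g x)] to a ball of radius at most 4 e^C. *)
have Bfin := discrete_bounded_finite iota_inj iota_discrete (4 * expR C).
apply: filterS (g_oo _ Bfin) => x xB; rewrite ltNge; apply/negP => tC; apply: xB => /=.
have [t0 -> k1 l1] := kl x.
have kn : `|val (k x)| <= 1 by apply: mx_norm_le.
have ln : `|val (l x)^-1%g| <= 1 by apply: mx_norm_le.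
have gn : `|val (geod (t x))| <= expR C.
  apply: mx_norm_le => [|i j]; first exact: expR_ge0.
  rewrite /= /diag_exp !mxE; case: (i == j); last by rewrite mulr0n normr0 expR_ge0.
  by rewrite mulr1n; case: ifP => _; rewrite gtr0_norm ?expR_gt0// ler_expR//; lra.
apply: le_trans (mxnorm_mulmx _ _) _; apply: le_trans (_ : _ <= 2 * (2 * 1 * expR C) * 1) _; last by lra.
apply: ler_pM => //; rewrite ler_pM2l//.
apply: le_trans (mxnorm_mulmx _ _) _.
by apply: ler_pM => //; rewrite ler_pM2l.
Qed.

Lemma finite_return (K : set (PV R * PVd R)) : compact K -> K `<=` domain f ->
  finite_set [set g | (actF (rho g) @` K) `&` K !=set0].
Proof.
move=> Kcomp KD; set S := [set g | _]; apply: contrapT => /infinite_ultrafilter[U [UU US Ufin]].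
(* A point of [K] that [rho g] returns to [K]; the default pair only occurs outside [S], which [U]
   neglects. *)
pose z g : PV R * PVd R := xget (pclass (const_mx 1), pclass (const_mx 1))
  [set z | K z /\ K (actF (rho g) z)].
have zP : \forall g \near U, K (z g) /\ K (actF (rho g) (z g)).
  apply: filterS US => g [_ [[y Ky <-] Kgy]].
  by rewrite /z; case: xgetP => [y' _ //|/(_ y)]; case.
have ccl (X : Gam -> PV R * PVd R) : (\forall g \near U, K (X g)) ->
    exists2 x, domain f x & X @ U --> x.
  move=> KX; have := Kcomp; rewrite compact_ultra => /(_ (X @ U) (fmap_ultrafilter X UU) KX).
  by move=> [x [/KD Dx Xx]]; exists x.
have [z0 z0D zz0] : exists2 x, domain f x & z @ U --> x.
  by apply: ccl; apply: filterS zP => g [].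
have [z1 z1D zz1] : exists2 x, domain f x & (fun g => actF (rho g) (z g)) @ U --> x.
  by apply: ccl; apply: filterS zP => g [].
have [u [u0 [un0 uz uu0 u00 u0E]]] := proj_lift_cvg UU (cvg_comp _ _ zz0 (@cvg_fst _ _ (nbhs z0.1) (nbhs z0.2) _)).
have [l [l0 [ln0 lz ll0 l00 l0E]]] := proj_lift_cvg UU (cvg_comp _ _ zz0 (@cvg_snd _ _ (nbhs z0.1) (nbhs z0.2) _)).
have z11 := cvg_comp _ _ zz1 (@cvg_fst _ _ (nbhs z1.1) (nbhs z1.2) (nbhs_filter _)).
have z12 := cvg_comp _ _ zz1 (@cvg_snd _ _ (nbhs z1.1) (nbhs z1.2) (nbhs_filter _)).
have kakP g : exists q : SL R 2 * SL R 2 * R,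
  [/\ 0 <= q.2, iota g = (q.1.1 * geod q.2 * q.1.2^-1)%g,
      forall i j, `|val q.1.1 i j| <= 1, forall i j, `|val q.1.2 i j| <= 1
    & forall i j, `|val (q.1.2^-1)%g i j| <= 1].
  by have [k [m [t kak]]] := cartan_decomposition (iota g); exists (k, m, t).
pose q g := sval (cid (kakP g)).
pose k g := (q g).1.1; pose m g := (q g).1.2; pose t g := (q g).2.
have kak g : [/\ 0 <= t g, iota g = (k g * geod (t g) * (m g)^-1)%g,
      forall i j, `|val (k g) i j| <= 1, forall i j, `|val (m g) i j| <= 1
    & forall i j, `|val ((m g)^-1)%g i j| <= 1].
  by rewrite /k /m /t /q; case: cid.
have [k0 kk0] : exists k0 : SL R 2, k @ U --> k0.
  by apply: SL_bounded_cvg => g i j; case: (kak g).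
have [m0 mm0] : exists m0 : SL R 2, m @ U --> m0.
  by apply: SL_bounded_cvg => g i j; case: (kak g).
have t_oo C : \forall g \near U, C < t g.
  by apply: (@cartan_escape _ U id k m t) => // g; case: (kak g).
have gE g : iota g = (k g * geod (t g) * (m g)^-1)%g by case: (kak g).
(* The Weyl element turns a^-t back into a^t, giving a decomposition of the inverse with the same
   [t] and the roles of [k] and [m] exchanged. *)
have gVE g : iota g^-1%g = (m g * weyl R * geod (t g) * (k g * weyl R)^-1)%g.
  rewrite multiplicativeV gE !invgM invgK -!mulgA; congr (_ * _)%g.
  by rewrite [(weyl R * _)%g]mulgA weyl_geod -!mulgA mulVKg.
have [p [p' [c [c' [pf p'f c0 cA cB]]]]] :=
  attracting_repelling_limits iota_inj iota_discrete s_anosov f_lifts_s UU gE kk0 mm0 t_oo.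
have kw : (fun g => k g * weyl R)%g @ U --> (k0 * weyl R)%g.
  by apply: cvg_SL_mul => //; exact: cvg_cst.
have mw : (fun g => m g * weyl R)%g @ U --> (m0 * weyl R)%g.
  by apply: cvg_SL_mul => //; exact: cvg_cst.
have [r [r' [d [d' [rf r'f d0 dA dB]]]]] :=
  attracting_repelling_limits iota_inj iota_discrete s_anosov f_lifts_s UU gVE mw kw t_oo.
rewrite !rank_oneE in cA cB dA dB.
have rhoV g : val (rho g^-1%g) = invmx (val (rho g)) by rewrite multiplicativeV.
have dA' : d g *: invmx (val (rho g)) @[g --> U] --> col 0 (val r) *m row 0 (invmx (val r')).
  by under eq_fun do rewrite -rhoV.
have dB' : d' g *: val (rho g) @[g --> U] --> col 2%:R (val r') *m row 2%:R (invmx (val r)).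
  by move: dB; under eq_fun do rewrite rhoV invmxK.
have unit_neq0 (A : 'M[R]_3) : A \in unitmx -> A != 0.
  by apply: contraTneq => ->; rewrite unitmxE det0 unitr0.
(* Two rescalings of the same [rho g] have proportional limits. The kernel of the limit is thus the
   line of the frame [r], which is a limit line. *)
have [al al0 AE] : exists2 al : R, al != 0 & col 2%:R (val r') *m row 2%:R (invmx (val r)) =
    al *: (col 0 (val p) *m row 0 (invmx (val p'))).
  apply: (scaled_limits _ _ _ _ _ cA dB'); rewrite ?rank_one_neq0// => g.
  - exact/unit_neq0/SL_unitmx.
  - by case: (c0 g).
  - by case: (d0 g).
have [be be0 BE] : exists2 be : R, be != 0 & col 0 (val r) *m row 0 (invmx (val r')) =
    be *: (col 2%:R (val p') *m row 2%:R (invmx (val p))).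
  apply: (scaled_limits _ _ _ _ _ cB dA'); rewrite ?rank_one_neq0// => g.
  - by apply: unit_neq0; rewrite unitmx_inv SL_unitmx.
  - by case: (c0 g).
  - by case: (d0 g).
have [Lp _] := limit_frame pf; have [_ Llp] := limit_frame pf.
have [Lr Llr] := limit_frame rf.
have [z0f z0p z0l] := z0D; have [_ z1p z1l] := z1D.
have colr' j : col j (val r') != 0 := col_neq0 _ _.
(* Otherwise the points of the flags [actF (rho g) (z g)] would tend to the attracting point, a
   limit point, whereas their limit flag [z1] is in the domain. *)
have case1 : row 2%:R (invmx (val r)) *m u0 = 0.
  apply: contrapT => /eqP; rewrite mx11_neq0 => ru.
  pose Au := col 0 (val p) *m row 0 (invmx (val p')) *m u0.
  have Au0 : Au != 0.
    have : al *: Au != 0.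
      by rewrite /Au scalemxAl -AE -mulmxA col_mulmx11 scaler_eq0 negb_or ru colr'.
    by apply: contra_neq => ->; rewrite scaler0.
  have AuE : Au = (row 0 (invmx (val p')) *m u0) 0 0 *: col 0 (val p).
    by rewrite /Au -mulmxA col_mulmx11.
  have e0 : (row 0 (invmx (val p')) *m u0) 0 0 != 0.
    by apply: contra_neq Au0 => e0; rewrite AuE e0 scale0r.
  apply: z1p; suff -> : z1.1 = pclass (col 0 (val p)) by [].
  rewrite -(pclassZ e0 (col_neq0 p 0)) -AuE.
  apply: (proj_cvg_unique z11).
  have E g : fst (actF (rho g) (z g)) = pclass ((c g *: val (rho g)) *m u g).
    have [cg _] := c0 g; rewrite /= -[(z g).1]uz actV_pclass// -scalemxAl pclassZ//.
    by apply: unitmx_neq0 => //; exact: SL_unitmx.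
  rewrite [X in X @ _](_ : _ = fun g => pclass ((c g *: val (rho g)) *m u g)); last exact/funext.
  exact: (cvg_pclass (cvg_mulmx cA uu0) Au0).
(* Dually, lines whose limit avoids the repelling point would be attracted to a limit line. *)
have case2 : l0 *m col 0 (val r) = 0.
  apply: contrapT => /eqP; rewrite mx11_neq0 => lr.
  pose lB := l0 *m (col 2%:R (val p') *m row 2%:R (invmx (val p))).
  have lB0 : lB != 0.
    have : be *: lB != 0.
      by rewrite /lB scalemxAr -BE mulmxA row_mulmx11 scaler_eq0 negb_or lr row_invmx_neq0.
    by apply: contra_neq => ->; rewrite scaler0.
  have lBE : lB = (l0 *m col 2%:R (val p')) 0 0 *: row 2%:R (invmx (val p)).
    by rewrite /lB mulmxA row_mulmx11.
  have e0 : (l0 *m col 2%:R (val p')) 0 0 != 0.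
    by apply: contra_neq lB0 => e0; rewrite lBE e0 scale0r.
  apply: z1l; suff -> : z1.2 = pclass (row 2%:R (invmx (val p))) by [].
  rewrite -(pclassZ e0 (row_invmx_neq0 p _)) -lBE.
  apply: (proj_cvg_unique z12).
  have E g : snd (actF (rho g) (z g)) = pclass (l g *m (c' g *: invmx (val (rho g)))).
    have [_ cg] := c0 g; rewrite /= -[(z g).2]lz actVd_pclass// -scalemxAr pclassZ//.
    apply: contra_neq (ln0 g) => lg0.
    by rewrite -(mulmxKV (SL_unitmx (rho g)) (l g)) lg0 mul0mx.
  rewrite [X in X @ _](_ : _ = fun g => pclass (l g *m (c' g *: invmx (val (rho g))))); last exact/funext.
  exact: (cvg_pclass (cvg_mulmx ll0 cB) lB0).
have lu : l0 *m u0 = 0 by apply/incidentP => //; rewrite u0E l0E.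
(* Both conditions involve the same frame [r], so [z0] shares its point or its line with a flag of
   the limit curve. *)
have [uE|lE] := flag_meet u00 l00 lu case1 case2.
- by apply: z0p; rewrite -[z0.1]u0E uE.
- by apply: z0l; rewrite -[z0.2]l0E lE.
Qed.

End Main.

Theorem theorem5p1 (R : realType) (Gam : groupType)
    (iota : {multiplicative Gam -> SL R 2})
    (rho : {multiplicative Gam -> SL R 3})
    (Gam_surface : negative_closed_surface_group Gam)
    (iota_inj : injective iota)
    (iota_discrete : discrete_subset (range iota))
    (s : M iota -> Erho iota rho) (s_anosov : anosov_section s)
    (f : SL R 2 -> Y R) (f_lifts_s : lifts f s) :
  [/\ acts_on (@actF R) (range rho) (domain f),
      acts_freely (@actF R) (range rho) (domain f)
    & acts_properly_discontinuously (@actF R) (range rho) (domain f)].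
Proof.
have fin := finite_return iota_inj iota_discrete s_anosov f_lifts_s.
split.
- by move=> _ x [g _ <-]; exact: (domain_act iota_inj f_lifts_s).
- move=> _ x [g _ <-] Dx gx; suff -> : g = 1%g by rewrite multiplicative1.
  have K1 : [set x] `<=` domain f by move=> _ ->.
  have gXx n : actF (rho (g ^+ n)%g) x = x.
    by elim: n => [|n IH]; rewrite ?multiplicative1 ?actF1// expgS gmulfM actFM IH.
  (* A point is compact, so only finitely many elements of [Gam] fix it, whereas the powers of a
     nontrivial [g] are pairwise distinct. *)
  have Sfin := fin _ (@compact_set1 _ x) K1.
  apply: contrapT => g1; apply: infinite_nat.
  have gX_inj n m : (n < m)%N -> (g ^+ n)%g <> (g ^+ m)%g.
    move=> nm gnm; apply: g1; apply: (surface_group_torsion_free (n := (m - n).-1) Gam_surface).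
    rewrite prednK ?subn_gt0//; apply: (mulgI (g ^+ n)%g).
    by rewrite -expgnDr subnKC ?mulg1// ltnW.
  have gXinj : {in (fun n => g ^+ n)%g @^-1` [set h | (actF (rho h) @` [set x]) `&` [set x] !=set0] &,
      injective (fun n => g ^+ n)%g}.
    move=> n m _ _ gnm.
    by have [/gX_inj/(_ gnm)|/gX_inj/(_ (esym gnm))|] := ltngtP n m.
  apply: sub_finite_set (finite_preimage gXinj Sfin) => n _.
  by exists x; split=> //; exists x.
- move=> K Kcomp KD; apply: sub_finite_set (finite_image rho (fin K Kcomp KD)).
  by move=> _ [[g _ <-] gK]; exists g.
Qed.
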